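(* There are a constant $\bar\epsilon_0>0$ and a function $C:[0,\bar\epsilon_0]\to(0,\infty)$ such that the following holds for every $N\ge1$ and every matroid on $[N]$. Let $\pi$ be the uniform distribution on the set of bases of the matroid, viewed as a probability measure on $\omega\in\{0,1\}^N$, let $(\epsilon_{ef})_{e,f\in[N]}$ be real numbers with $\epsilon_{ef}=\epsilon_{fe}>-1$, and let $\mu$ be the probability measure $$\mu(\omega)\propto\prod_{e,f\in[N]}(1+\epsilon_{ef}\,\omega_e\omega_f)\,\pi(\omega).$$ If $\bar\epsilon=\max_e\sum_f|\epsilon_{ef}|\le\bar\epsilon_0$, then the down-up walk on $\mu$ satisfies the modified log-Sobolev inequality $$\mathrm{Ent}_\mu(F)\le C(\bar\epsilon)\,D^{\mathrm{du}}_\mu(F,\log F)$$ for every function $F$ from the support of $\mu$ to $(0,\infty)$.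
   Context: The set of bases of a matroid on $[N]=\{1,\dots,N\}$ is any nonempty collection $\mathcal B$ of subsets of $[N]$ such that if $A,B\in\mathcal B$ and $a\in A\setminus B$ then there is $b\in B\setminus A$ with $(A\setminus\{a\})\cup\{b\}\in\mathcal B$. A set $I\subset[N]$ is identified with $\omega\in\{0,1\}^N$ by $\omega_e=1$ iff $e\in I$; write $I(\omega)=\{e:\omega_e=1\}$. $\mathrm{Ent}_\mu(F)=\mathbb E_\mu[F\log F]-\mathbb E_\mu[F]\log\mathbb E_\mu[F]$. Down-up walk (bases-exchange walk): for $\omega$ in the support of $\mu$ and $i\in I(\omega)$, let $J_i(\omega)$ be the set of $k\in[N]\setminus(I(\omega)\setminus\{i\})$ such that $(I(\omega)\setminus\{i\})\cup\{k\}\in\mathcal B$ (so $i\in J_i(\omega)$), and let $\omega^{ij}$ be obtained from $\omega$ by exchanging $\omega_i$ and $\omega_j$ ($\omega^{ii}=\omega$). The Dirichlet form is $$D^{\mathrm{du}}_\mu(F,G)=\frac12\sum_\omega\mu(\omega)\sum_{i\in I(\omega)}\ \sum_{j\in J_i(\omega)}\frac{\mu(\omega^{ij})}{\sum_{k\in J_i(\omega)}\mu(\omega^{ik})}\,(F(\omega^{ij})-F(\omega))(G(\omega^{ij})-G(\omega)).$$ *)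

(* Defs.v *)
From HB Require Import structures.
From mathcomp Require Import all_boot all_order all_algebra all_fingroup.
From mathcomp Require Import all_classical all_reals all_analysis.

Set Implicit Arguments.
Unset Strict Implicit.
Unset Printing Implicit Defensive.

Import Order.TTheory GRing.Theory Num.Theory.
Local Open Scope ring_scope.

Definition config (N : nat) := {ffun 'I_N -> bool}.

Definition occ (N : nat) (w : config N) : {set 'I_N} := [set e | w e].

Definition is_matroid_bases (N : nat) (B : {set {set 'I_N}}) : Prop :=
  (exists A, A \in B) /\
  (forall A A' : {set 'I_N}, A \in B -> A' \in B ->
   forall a, a \in A :\: A' ->
   exists2 b, b \in A' :\: A & (A :\ a) :|: [set b] \in B).

(* Probability measures on the finite space [config N] are represented by
   their mass functions. *)
Definition unif_bases (R : realType) (N : nat) (B : {set {set 'I_N}})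
    (w : config N) : R :=
  (occ w \in B)%:R / #|B|%:R.

(* The product runs over ordered pairs, including the diagonal. *)
Definition tilt_weight (R : realType) (N : nat) (eps : 'I_N -> 'I_N -> R)
    (B : {set {set 'I_N}}) (w : config N) : R :=
  (\prod_(e < N) \prod_(f < N) (1 + eps e f * (w e)%:R * (w f)%:R))
    * unif_bases R B w.

Definition tilt (R : realType) (N : nat) (eps : 'I_N -> 'I_N -> R)
    (B : {set {set 'I_N}}) (w : config N) : R :=
  tilt_weight eps B w / \sum_(v : config N) tilt_weight eps B v.

(* The row sums are nonnegative, so the default value 0 does not affect the
   maximum when 0 < N. *)
Definition eps_bar (R : realType) (N : nat) (eps : 'I_N -> 'I_N -> R) : R :=
  \big[Num.max/0]_(e < N) \sum_(f < N) `|eps e f|.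

Definition Emu (R : realType) (N : nat) (mu : config N -> R)
    (F : config N -> R) : R :=
  \sum_(w : config N) mu w * F w.

Definition Ent (R : realType) (N : nat) (mu : config N -> R)
    (F : config N -> R) : R :=
  Emu mu (fun w => F w * ln (F w)) - Emu mu F * ln (Emu mu F).

Definition exch (N : nat) (w : config N) (i j : 'I_N) : config N :=
  [ffun e => w (tperm i j e)].

Definition J (N : nat) (B : {set {set 'I_N}}) (w : config N) (i : 'I_N) :
    {set 'I_N} :=
  [set k in ~: (occ w :\ i) | (occ w :\ i) :|: [set k] \in B].

(* The terms with [mu w = 0] vanish, so only [w] in the support of [mu]
   contribute. *)
Definition D_du (R : realType) (N : nat) (B : {set {set 'I_N}})
    (mu : config N -> R) (F G : config N -> R) : R :=
  2^-1 * \sum_(w : config N) mu w *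
    \sum_(i in occ w) \sum_(j in J B w i)
      (mu (exch w i j) / \sum_(k in J B w i) mu (exch w i k)) *
      (F (exch w i j) - F w) * (G (exch w i j) - G w).

(* Main.v *)
Require Import Defs.
From HB Require Import structures.
From mathcomp Require Import all_boot all_order all_algebra all_fingroup.
From mathcomp Require Import all_classical all_reals all_analysis.
From mathcomp Require Import ring lra.

(* Write [th_ef = ln (1 + eps_ef)].  The weight of a basis [S] is the endpoint
   [t = 1] of the family [exp (sum_(e in S) h_e + t * sum_(e, f in S) th_ef)],
   taken over all external fields [h].

   At [t = 0] the generating polynomial of the bases is log-concave for every
   field (trickle-down from matroid links of rank two), which bounds the
   covariance by the identity and, through entropic independence, factorises
   the entropy into the entropies of the links
   [{tau + i : i notin tau}].

   To go from [t] to [t + 1 / m], attach to each pair [(e, f)] an independent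
   sign whose mean, given [S], is affine in [1_(e in S)] and [1_(f in S)] and
   chosen so that conditioning on the sign trades the factor [exp (th_ef / m)]
   for an external field.  The weight at [t + 1 / m] is thus a mixture of
   weights at [t], and the information carried by the signs is at most
   [O (eps_bar / m)] times the sum over [e] of the squared shifts of the means
   of [1_(e in S)], up to [O_N (1 / m^2)].  A covariance bound, propagated by
   the same recursion, controls these shifts by the entropy, so that each of
   the [m] steps costs a factor [1 + O (1 / m)].  Since the sum of the link
   entropies is superadditive in the measure, the factorisation survives the
   mixture.  Finally the entropy of a link is at most the covariance of [F] and
   [ln F] on it, which is its share of the Dirichlet form. *)

Set Implicit Arguments.
Unset Strict Implicit.
Unset Printing Implicit Defensive.

Import Order.TTheory GRing.Theory Num.Theory.
Import numFieldNormedType.Exports.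
Local Open Scope ring_scope.

(** * Entropy of finite measures *)

(** The interaction is decoupled pair by pair because only the row sums of [th] are controlled: its
    entries have either sign and the matrix need not be definite. The resulting fields are
    arbitrary, so every bound on the way has to hold at all fields.

    The obstacle is a circularity: the information in the signs is controlled by the covariance at
    [t + 1 / m], the very quantity to be bounded. The trivial bound [N] breaks it. As
    [m >= 4 N ^ 4], even this poor bound loses at most a factor 2 in one step, and a second pass
    with the resulting bound 4 gives the right order.

    The number of steps depends on [N], the total loss does not: a step costs a factor
    [1 / (1 - 40 Theta / m)], where [Theta] bounds the row sums of [|th|], and these multiply to at
    most [1 / (1 - 40 Theta)]. With [Theta = 1 / 80] this is 2, the constant of the inequality. *)

Lemma sum_CauchySchwarz (R : realFieldType) (T : finType) (a x y : T -> R) :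
  (forall i, 0 <= a i) ->
  (\sum_i a i * x i * y i) ^+ 2 <=
  (\sum_i a i * x i ^+ 2) * (\sum_i a i * y i ^+ 2).
Proof.
move=> a0.
set P := \sum_i a i * x i * y i; set X := \sum_i _; set Y := \sum_i _.
have Y0 : 0 <= Y by apply: sumr_ge0 => i _; rewrite mulr_ge0 ?sqr_ge0.
have H : 0 <= Y * (X * Y - P ^+ 2).
  have -> : Y * (X * Y - P ^+ 2) = \sum_i a i * (Y * x i - P * y i) ^+ 2.
    transitivity (Y ^+ 2 * X - 2 * Y * P * P + P ^+ 2 * Y); first by ring.
    rewrite [X in _ - X + _]mulr_sumr [X in X - _ + _]mulr_sumr [X in _ + X]mulr_sumr.
    by rewrite -sumrB -big_split /=; apply: eq_bigr => i _; ring.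
  by apply: sumr_ge0 => i _; rewrite mulr_ge0 ?sqr_ge0.
have [Y00|Yn0] := eqVneq Y 0; last first.
  by move: H; rewrite pmulr_rge0 ?lt_neqAle 1?eq_sym ?Yn0 // subr_ge0.
suff -> : P = 0 by rewrite Y00 mulr0 expr0n.
apply: big1 => i _.
have /eqP : a i * y i ^+ 2 = 0.
  have := Y00; rewrite /Y => /eqP; rewrite psumr_eq0; last first.
    by move=> j _; rewrite mulr_ge0 ?sqr_ge0.
  by move/allP => /(_ i (mem_index_enum i)) /eqP.
by rewrite mulf_eq0 expf_eq0 /= => /orP [/eqP->|/eqP->]; rewrite ?mulr0 ?mul0r.
Qed.

Section FiniteEntropy.
Variables (R : realType) (T : finType).
Implicit Types a F G : T -> R.

Lemma ln_le_subr1 (x : R) : 0 < x -> ln x <= x - 1.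
Proof.
move=> x0; have := @le_ln1Dx R (x - 1).
by rewrite (_ : 1 + (x - 1) = x); [apply; lra|ring].
Qed.

(* For a measure [a] that is not normalised this is the entropy of [F] under
   the probability [a / \sum_i a i], times the mass; it is 0 for [a = 0]. *)
Definition fent a F : R :=
  \sum_i a i * (F i * ln (F i))
  - (\sum_i a i * F i) * ln ((\sum_i a i * F i) / \sum_i a i).

Lemma sum_mul_gt0 a F : (forall i, 0 <= a i) -> (forall i, 0 < F i) ->
  0 < \sum_i a i -> 0 < \sum_i a i * F i.
Proof.
move=> a0 F0 Z0; rewrite lt_neqAle sumr_ge0 ?andbT; last first.
  by move=> i _; rewrite mulr_ge0 // ltW.
apply/negP => /eqP /esym/eqP; rewrite psumr_eq0; last first.
  by move=> i _; rewrite mulr_ge0 // ltW.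
move=> /allP H; suff : \sum_i a i = 0 by move=> H0; rewrite H0 ltxx in Z0.
apply: big1 => i _; have := H i (mem_index_enum i).
by rewrite mulf_eq0 => /orP [/eqP//|/eqP Fi]; have := F0 i; rewrite Fi ltxx.
Qed.

Lemma mass_dichotomy a : (forall i, 0 <= a i) ->
  (forall i, a i = 0) \/ 0 < \sum_i a i.
Proof.
move=> a0; have [Z0|Z0] := eqVneq (\sum_i a i) 0; [left|right].
  move=> i; move/eqP: Z0; rewrite psumr_eq0 // => /allP/(_ i (mem_index_enum i)).
  by move/eqP.
by rewrite lt_neqAle eq_sym Z0 sumr_ge0.
Qed.

(** The inequality [ln x <= x - 1] at [x = M G / (N F)], weighted by [a F], where [M] and [N] are
    the totals of [F] and [G]: the right-hand sides sum to 0. *)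
Lemma fent_donsker_varadhan a F G : (forall i, 0 <= a i) ->
  (forall i, 0 < F i) -> (forall i, 0 < G i) ->
  \sum_i a i * (F i * ln (G i))
    - (\sum_i a i * F i) * ln ((\sum_i a i * G i) / \sum_i a i)
  <= fent a F.
Proof.
move=> a0 F0 G0; have [az|Z0] := mass_dichotomy a0.
  have e K : \sum_i a i * K i = 0 by apply: big1 => i _; rewrite az mul0r.
  by rewrite /fent !e !mul0r.
have M0 := sum_mul_gt0 a0 F0 Z0; have N0 := sum_mul_gt0 a0 G0 Z0.
rewrite /fent !lnM ?posrE ?invr_gt0 // lerBlDr.
move: M0 N0; set M := \sum_i a i * F i; set N := \sum_i a i * G i => M0 N0.
have H i : a i * (F i * (ln M - ln N) + F i * ln (G i) - F i * ln (F i)) <=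
    a i * (M / N * G i - F i).
  apply: ler_wpM2l => //.
  have p : 0 < M / N * G i / F i by rewrite !mulr_gt0 ?invr_gt0.
  have := ler_wpM2l (ltW (F0 i)) (ln_le_subr1 p).
  rewrite !lnM ?posrE ?mulr_gt0 ?invr_gt0 // !lnV ?posrE // => h.
  have e : F i * (M / N * G i / F i - 1) = M / N * G i - F i.
    by field; rewrite (gt_eqF (F0 i)) (gt_eqF N0).
  by move: h; rewrite e; lra.
have := ler_sum (index_enum T) (fun i (_ : true) => H i).
have -> : \sum_i a i * (M / N * G i - F i) = 0.
  transitivity (M / N * N - M); last by field; rewrite gt_eqF.
  by rewrite /M /N mulr_sumr -sumrB; apply: eq_bigr => i _; ring.
have -> : \sum_i a i * (F i * (ln M - ln N) + F i * ln (G i) - F i * ln (F i))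
  = M * (ln M - ln N) + \sum_i a i * (F i * ln (G i))
    - \sum_i a i * (F i * ln (F i)).
  rewrite /M mulr_suml -big_split -sumrB; apply: eq_bigr => i _ /=; ring.
lra.
Qed.

Lemma fent_ge0 a F : (forall i, 0 <= a i) -> (forall i, 0 < F i) ->
  0 <= fent a F.
Proof.
move=> a0 F0; have := @fent_donsker_varadhan a F (fun=> 1) a0 F0 (fun=> ltr01).
rewrite big1; last by move=> i _; rewrite ln1 !mulr0.
have -> : \sum_i a i * 1 = \sum_i a i by apply: eq_bigr => i _; rewrite mulr1.
have [az|Z0] := mass_dichotomy a0.
  by rewrite [X in X / X]big1 // mul0r ln0 // mulr0 subr0.
by rewrite divff ?gt_eqF // ln1 mulr0 subr0.
Qed.

Lemma eq_fent a a' F : a =1 a' -> fent a F = fent a' F.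
Proof. by move=> /funext->. Qed.

Lemma fent0 F : fent (fun=> 0) F = 0.
Proof. by rewrite /fent !big1 ?mul0r ?subr0 // => i _; rewrite mul0r. Qed.

Lemma fentZ (C : R) a F : 0 < C -> fent (fun i => C * a i) F = C * fent a F.
Proof.
move=> C0; rewrite /fent mulrBr.
have e G : \sum_i C * a i * G i = C * \sum_i a i * G i.
  by rewrite mulr_sumr; apply: eq_bigr => i _; rewrite mulrA.
rewrite !e -mulr_sumr -mulf_div divff ?gt_eqF // mul1r; ring.
Qed.

(** The Bregman divergence of [x * ln x]: its excess at [x] over the tangent at [c]. *)
Definition relent (c x : R) : R := x * ln x - x * ln c - x + c.

(** The two sides differ by the mass times [relent c] of the mean of [F]; the best [c] is therefore
    the mean, where equality holds. *)
Lemma fent_le_relent a F (c : R) : (forall i, 0 <= a i) -> (forall i, 0 < F i) ->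
  0 < c -> fent a F <= \sum_i a i * relent c (F i).
Proof.
move=> a0 F0 c0; have [az|Z0] := mass_dichotomy a0.
  by rewrite (funext az) fent0 big1 // => i _; rewrite mul0r.
have M0 := sum_mul_gt0 a0 F0 Z0.
have -> : \sum_i a i * relent c (F i) = \sum_i a i * (F i * ln (F i)) -
    (\sum_i a i * F i) * ln c - \sum_i a i * F i + c * \sum_i a i.
  rewrite [X in _ - X - _ + _]mulr_suml [X in _ + X]mulr_sumr -!sumrB -big_split; apply: eq_bigr => i _ /=.
  by rewrite /relent; ring.
rewrite /fent; move: M0; set M := \sum_i a i * F i => M0.
move: Z0; set Z := \sum_i a i => Z0.
have p : 0 < c * Z / M by rewrite !mulr_gt0 ?invr_gt0.
have := ler_wpM2l (ltW M0) (ln_le_subr1 p).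
have -> : M * (c * Z / M - 1) = c * Z - M by field; rewrite gt_eqF.
rewrite !lnM ?posrE ?mulr_gt0 ?invr_gt0 // !lnV ?posrE //; lra.
Qed.

Lemma fent_relent a F : (forall i, 0 <= a i) -> (forall i, 0 < F i) ->
  fent a F = \sum_i a i * relent ((\sum_i a i * F i) / \sum_i a i) (F i).
Proof.
move=> a0 F0; have [az|Z0] := mass_dichotomy a0.
  by rewrite (funext az) fent0 big1 // => i _; rewrite mul0r.
rewrite /fent; move: Z0; set Z := \sum_i a i => Z0; set M := \sum_i a i * F i.
have -> : \sum_i a i * relent (M / Z) (F i) = \sum_i a i * (F i * ln (F i)) -
    M * ln (M / Z) - M + M / Z * Z.
  rewrite [X in _ - X - _ + _]mulr_suml [X in _ + X]mulr_sumr -!sumrB -big_split; apply: eq_bigr => i _ /=.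
  by rewrite /relent; ring.
by rewrite divfK ?gt_eqF // subrK.
Qed.

(* As a function of the measure, the entropy is an infimum of linear forms. *)
Lemma fent_superadditive (S : finType) (b : S -> T -> R) F :
  (forall s i, 0 <= b s i) -> (forall i, 0 < F i) ->
  \sum_s fent (b s) F <= fent (fun i => \sum_s b s i) F.
Proof.
move=> b0 F0; have a0 i : 0 <= \sum_s b s i by apply: sumr_ge0.
have [az|Z0] := mass_dichotomy a0.
  rewrite (funext az) fent0 big1 // => s _; rewrite (_ : b s = fun=> 0) ?fent0 //.
  apply/funext => i; move/eqP: (az i); rewrite psumr_eq0 //.
  by move/allP => /(_ s (mem_index_enum s)) /eqP.
rewrite [leRHS]fent_relent //.
have M0 := sum_mul_gt0 a0 F0 Z0.
set c := (X in relent X); have c0 : 0 < c by rewrite mulr_gt0 ?invr_gt0.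
under [leRHS]eq_bigr do rewrite mulr_suml.
by rewrite exchange_big /=; apply: ler_sum => s _; apply: fent_le_relent.
Qed.

(** With [x = p ^ 2] and [c = q ^ 2], the divergence dominates the squared Hellinger distance
    [(p - q) ^ 2], and [(p + q) ^ 2 <= 2 (x + c)]. *)
Lemma relent_hellinger (c x : R) : 0 < c -> 0 < x ->
  (x - c) ^+ 2 <= 2 * (x + c) * relent c x.
Proof.
move=> c0 x0.
have sq (y : R) : 0 < y -> exists2 p, 0 < p & y = p ^+ 2.
  by move=> y0; exists (Num.sqrt y); rewrite ?sqrtr_gt0 ?sqr_sqrtr ?ltW.
have [p p0 xE] := sq _ x0; have [q q0 cE] := sq _ c0.
have H : (p - q) ^+ 2 <= relent c x.
  have r0 : 0 < q / p by rewrite mulr_gt0 ?invr_gt0.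
  have := ler_wpM2l (ltW x0) (ln_le_subr1 r0).
  have -> : x * (q / p - 1) = p * q - p ^+ 2 by rewrite xE; field; rewrite gt_eqF.
  rewrite /relent xE cE lnM ?posrE ?invr_gt0 // lnV ?posrE // !lnXn //.
  by lra.
apply: le_trans (_ : 2 * (x + c) * (p - q) ^+ 2 <= _); last first.
  by apply: ler_wpM2l => //; rewrite mulr_ge0 ?addr_ge0 ?ltW.
rewrite xE cE (_ : (p ^+ 2 - q ^+ 2) ^+ 2 = (p + q) ^+ 2 * (p - q) ^+ 2); last by ring.
apply: ler_wpM2r; rewrite ?sqr_ge0 // -subr_ge0.
by rewrite (_ : _ - _ = (p - q) ^+ 2) ?sqr_ge0 //; ring.
Qed.

(** Pinsker's inequality for an unnormalised measure, by Cauchy-Schwarz against the weight [F + c].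
    The constant 4 is not optimal, but it only enters a term of second order in the step. *)
Lemma fent_pinsker a F : (forall i, 0 <= a i) -> (forall i, 0 < F i) ->
  (\sum_i a i * `|F i - (\sum_i a i * F i) / \sum_i a i|) ^+ 2 <=
  4 * (\sum_i a i * F i) * fent a F.
Proof.
move=> a0 F0; have [az|Z0] := mass_dichotomy a0.
  by rewrite (funext az) !big1 ?mulr0 ?mul0r ?expr0n //= => i _; rewrite mul0r.
rewrite fent_relent //; have M0 := sum_mul_gt0 a0 F0 Z0.
move: Z0 M0; set Z := \sum_i a i; set M := \sum_i a i * F i => Z0 M0.
set c := M / Z; have c0 : 0 < c by rewrite divr_gt0.
have p i : 0 < F i + c by rewrite addr_gt0.
pose x i := `|F i - c| / Num.sqrt (F i + c).
pose y i := Num.sqrt (F i + c).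
have y0 i : 0 < y i by rewrite sqrtr_gt0.
have -> : \sum_i a i * `|F i - c| = \sum_i a i * x i * y i.
  by apply: eq_bigr => i _; rewrite /x -mulrA divfK // gt_eqF ?y0.
apply: le_trans (sum_CauchySchwarz x y a0) _.
have -> : \sum_i a i * y i ^+ 2 = 2 * M.
  transitivity (M + c * Z); last by rewrite /c divfK ?gt_eqF // mulr2n mulrDl mul1r.
  rewrite /M /Z mulr_sumr -big_split; apply: eq_bigr => i _ /=.
  by rewrite sqr_sqrtr ?ltW //; ring.
rewrite (_ : 4 * M * _ = (2 * \sum_i a i * relent c (F i)) * (2 * M)); last by ring.
apply: ler_wpM2r; first by rewrite mulr_ge0 ?ltW.
rewrite mulr_sumr; apply: ler_sum => i _; rewrite [leRHS]mulrCA ler_wpM2l //.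
rewrite /x expr_div_n sqr_sqrtr ?(ltW (p i)) // ler_pdivrMr // real_normK ?num_real //.
by have := relent_hellinger c0 (F0 i); lra.
Qed.

End FiniteEntropy.

(** * Second-order expansion of log-partition functions *)

Section LogTaylor.
Variable R : realType.

Lemma is_derive_finsum (T : finType) (h : T -> R -> R) (dh : T -> R) (x : R) :
  (forall i, is_derive x 1 (h i) (dh i)) ->
  is_derive x 1 (fun t => \sum_i h i t) (\sum_i dh i).
Proof.
move=> H; elim: (index_enum T) => [|i s IH].
  rewrite big_nil (_ : (fun _ => _) = cst 0); last by apply/funext => t; rewrite big_nil.
  exact: is_derive_cst.
rewrite big_cons (_ : (fun _ => _) = h i \+ (fun t => \sum_(j <- s) h j t)).
  exact: is_deriveD.
by apply/funext => t; rewrite big_cons.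
Qed.

Lemma is_derive_within (f df : R -> R) (a b : R) :
  (forall t : R, a <= t <= b -> is_derive t 1 f (df t)) ->
  {within `[a, b], continuous f}%classic.
Proof.
move=> H; apply: derivable_within_continuous => t; rewrite in_itv /= => /H h.
exact: ex_derive.
Qed.

Lemma le_of_derive_le0 (f df : R -> R) (b : R) : 0 <= b ->
  (forall t : R, 0 <= t <= b -> is_derive t 1 f (df t)) ->
  (forall t : R, 0 <= t <= b -> df t <= 0) -> f b <= f 0.
Proof.
rewrite le_eqVlt => /predU1P [<-//|b0] H H0.
have [t||t tI] := @MVT R f df 0 b b0.
- by rewrite in_itv /= => /andP [t0 tb]; apply: H; rewrite !ltW.
- exact: is_derive_within H.
- move=> e; rewrite -subr_le0 e subr0; move: tI; rewrite in_itv /= => /andP [t0 tb].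
  by apply: mulr_le0_ge0; [apply: H0; rewrite !ltW|exact: ltW].
Qed.

(** The last hypothesis bounds the second derivative of [ln g] by [K]. Monotonicity replaces
    integration: [g1 / g - K t], and then [ln g] minus its quadratic majorant, are nonincreasing. *)
Lemma ln_second_order (g g1 g2 : R -> R) (K : R) :
  (forall t : R, 0 <= t <= 1 -> is_derive t 1 g (g1 t)) ->
  (forall t : R, 0 <= t <= 1 -> is_derive t 1 g1 (g2 t)) ->
  (forall t : R, 0 <= t <= 1 -> 0 < g t) ->
  (forall t : R, 0 <= t <= 1 -> g2 t * g t - g1 t ^+ 2 <= K * g t ^+ 2) ->
  ln (g 1) <= ln (g 0) + g1 0 / g 0 + K / 2.
Proof.
move=> d1 d2 g0 gK.
have d1' s : 0 <= s <= 1 -> g1 s / g s - K * s <= g1 0 / g 0.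
  move=> /andP [s0 s1].
  pose psi (t : R) := g1 t * (g t)^-1 - K * t.
  pose dpsi t := (g2 t * g t - g1 t ^+ 2) / g t ^+ 2 - K.
  suff : psi s <= psi 0 by rewrite /psi mulr0 subr0.
  apply: (@le_of_derive_le0 psi dpsi) => // t /andP [t0 ts].
    have tI : 0 <= t <= 1 by rewrite t0 (le_trans ts).
    have gt := g0 _ tI; have h1 := d1 _ tI; have h2 := d2 _ tI.
    have h3 : is_derive t 1 (fun x => (g x)^-1) (- (g t) ^- 2 *: g1 t).
      by apply: is_deriveV; rewrite gt_eqF.
    have h4 := is_deriveM h2 h3.
    have h5 : is_derive t 1 (K \*: (@id R)) (K *: 1) by exact: is_deriveZ.
    have := is_deriveB h4 h5.
    rewrite (_ : _ - _ = psi); last by apply/funext => x; rewrite /psi !fctE.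
    move=> h; apply: is_derive_eq.
    by rewrite /dpsi /GRing.scale /=; field; rewrite gt_eqF.
  have tI : 0 <= t <= 1 by rewrite t0 (le_trans ts).
  by rewrite /dpsi subr_le0 ler_pdivrMr ?gK // exprn_gt0 ?g0.
pose c := g1 0 / g 0.
pose phi (t : R) := ln (g t) - c * t - K / 2 * t ^+ 2.
suff : phi 1 <= phi 0.
  by rewrite /phi expr0n expr1n /= !mulr0 !subr0 !mulr1 -/c; lra.
pose dphi t := g1 t / g t - c - K * t.
apply: (@le_of_derive_le0 phi dphi) => // t tI; last first.
  by rewrite /dphi; have := d1' _ tI; rewrite -/c; lra.
have gt := g0 _ tI; have h1 := d1 _ tI.
have h2 := is_derive1_comp (is_derive1_ln gt) h1.
have h5 : is_derive t 1 (c \*: (@id R)) (c *: 1) by exact: is_deriveZ.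
have h6 : is_derive t 1 ((K / 2) \*: ((@id R) ^+ 2)) ((K / 2) *: (2%:R * t ^+ 1 *: 1)).
  by apply: is_deriveZ.
have := is_deriveB (is_deriveB h2 h5) h6.
rewrite (_ : _ - _ = phi); last by apply/funext => x; rewrite /phi !fctE.
by move=> h; apply: is_derive_eq; rewrite /dphi /GRing.scale /=; field; rewrite gt_eqF.
Qed.

(** The second derivative of the log-partition function is the variance of [Y1] plus the mean of
    [Y2] under the tilted law. Two uses: exponents linear in [t], where [K] is a covariance bound,
    and sums of [ln (1 + t v_e)], where [K = 0] expresses log-concavity of the generating
    polynomial. *)
Lemma ln_sum_expR_second_order (T : finType) (a : T -> R) (Y Y1 Y2 : T -> R -> R)
    (K : R) :
  (forall S, 0 <= a S) -> 0 < \sum_S a S ->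
  (forall S (t : R), 0 <= t <= 1 -> is_derive t 1 (Y S) (Y1 S t)) ->
  (forall S (t : R), 0 <= t <= 1 -> is_derive t 1 (Y1 S) (Y2 S t)) ->
  (forall t : R, 0 <= t <= 1 ->
    (\sum_S a S * expR (Y S t) * (Y1 S t ^+ 2 + Y2 S t)) *
      (\sum_S a S * expR (Y S t)) - (\sum_S a S * expR (Y S t) * Y1 S t) ^+ 2
    <= K * (\sum_S a S * expR (Y S t)) ^+ 2) ->
  ln (\sum_S a S * expR (Y S 1)) <= ln (\sum_S a S * expR (Y S 0)) +
    (\sum_S a S * expR (Y S 0) * Y1 S 0) / (\sum_S a S * expR (Y S 0)) + K / 2.
Proof.
move=> a0 Z0 dY dY1 HK.
pose g t := \sum_S a S * expR (Y S t).
pose g1 t := \sum_S a S * expR (Y S t) * Y1 S t.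
pose g2 t := \sum_S a S * expR (Y S t) * (Y1 S t ^+ 2 + Y2 S t).
have dE S (t : R) : 0 <= t <= 1 ->
    is_derive t 1 (fun t => a S * expR (Y S t)) (a S * expR (Y S t) * Y1 S t).
  move=> tI; have h := dY S t tI.
  have h1 := is_derive1_comp (is_derive_expR (Y S t)) h.
  have h2 : is_derive t 1 (a S \*: (expR \o Y S)) (a S *: (expR (Y S t) * Y1 S t)).
    exact: is_deriveZ.
  by apply: is_derive_eq; rewrite /GRing.scale /= mulrA.
apply: (@ln_second_order g g1 g2 K) => // t tI.
- by apply: is_derive_finsum => S; exact: dE.
- apply: is_derive_finsum => S.
  have h := is_deriveM (dE S t tI) (dY1 S t tI).
  by apply: is_derive_eq; rewrite /GRing.scale /=; ring.
- exact: (sum_mul_gt0 a0 (fun S => expR_gt0 (Y S t)) Z0).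
Qed.

End LogTaylor.

(** * Observing independent signs *)

Section SignChannel.
Variable R : realType.

Lemma prod_1D_remainder (T : Type) (s : seq T) (x : T -> R) :
  \sum_(j <- s) `|x j| <= 1 ->
  `|\prod_(j <- s) (1 + x j) - 1 - \sum_(j <- s) x j|
    <= (\sum_(j <- s) `|x j|) ^+ 2.
Proof.
elim: s => [|y s IH].
  by rewrite !big_nil subrr subr0 normr0 expr0n.
rewrite !big_cons.
set P := \prod_(j <- s) _; set L := \sum_(j <- s) x j.
set A := \sum_(j <- s) `|x j| => A1.
have A0 : 0 <= A by apply: sumr_ge0.
have y0 := normr_ge0 (x y).
have LA : `|L| <= A by apply: ler_norm_sum.
have /IH PL : A <= 1 by lra.
have -> : (1 + x y) * P - 1 - (x y + L) = (P - 1 - L) + x y * ((P - 1 - L) + L).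
  by ring.
apply: le_trans (ler_normD _ _) _; rewrite normrM.
have h : `|P - 1 - L + L| <= 2 * A.
  by apply: le_trans (ler_normD _ _) _; move: PL; rewrite -/P -/L -/A; nra.
have := ler_wpM2l y0 h; move: PL; rewrite -/P -/L -/A.
move: y0; set u := `|x y|; set v := `|_ - L|; set w := _ * `|_|.
nra.
Qed.

Lemma prod_1B_ge (T : Type) (s : seq T) (x : T -> R) :
  (forall j, 0 <= x j <= 1) ->
  1 - \sum_(j <- s) x j <= \prod_(j <- s) (1 - x j).
Proof.
move=> x01; elim: s => [|y s IH]; first by rewrite !big_nil subr0.
rewrite !big_cons; have /andP [y0 y1] := x01 y.
have h : 0 <= \sum_(j <- s) x j by apply: sumr_ge0 => j _; have /andP [] := x01 j.
have := ler_wpM2l (_ : 0 <= 1 - x y) IH; rewrite subr_ge0 => /(_ y1).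
nra.
Qed.

Variables (T J : finType) (c : J -> T -> R).

(* The conditional law given [S] of independent signs [s j], the sign [s j]
   having mean [c j S]; [true] encodes the sign -1. *)
Definition sign_channel (s : {ffun J -> bool}) (S : T) : R :=
  \prod_j (2^-1 * (1 + (-1) ^+ (s j) * c j S)).

Lemma sum_sign_channel S : \sum_s sign_channel s S = 1.
Proof.
rewrite /sign_channel
  -(bigA_distr_bigA (fun j (b : bool) => 2^-1 * (1 + (-1) ^+ b * c j S))) /=.
apply: big1 => j _; rewrite big_bool /= expr0 expr1; lra.
Qed.

(** Small amplitudes keep the density of the signs relative to fair signs above 1/2, so each
    denominator may be replaced by half its value for fair signs. What remains is a second moment
    under fair signs, which is explicit. *)
Lemma sign_channel_chi2 (alpha : J -> R) (a rho : T -> R) :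
  (forall j S, `|c j S| <= alpha j) -> \sum_j alpha j <= 2^-1 ->
  (forall S, 0 <= a S) -> 0 < \sum_S a S -> \sum_S rho S = 0 ->
  \sum_s (\sum_S rho S * sign_channel s S) ^+ 2 / (\sum_S a S * sign_channel s S)
  <= 2 / (\sum_S a S) * (\sum_j (\sum_S rho S * c j S) ^+ 2
       + (\sum_j alpha j ^+ 2) ^+ 2 * (\sum_S `|rho S|) ^+ 2).
Proof.
move=> c_le alpha_le a0 Z0 rho0; set Z := \sum_S a S in Z0 *.
have [S0 _|T0] := pickP (predT : pred T); last first.
  by move: Z0; rewrite /Z big_pred0 ?ltxx.
have al0 j : 0 <= alpha j by apply: le_trans (c_le j S0).
have al1 j : 0 <= alpha j <= 1.
  rewrite al0 /=; apply: le_trans (_ : \sum_j alpha j <= 1); last by lra.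
  by rewrite (bigD1 j) //= lerDl sumr_ge0.
pose w : R := \prod_(j : J) 2^-1.
have w0 : 0 < w by apply: prodr_gt0 => j _; rewrite invr_gt0.
pose p (s : {ffun J -> bool}) S := \prod_j (1 + (-1) ^+ (s j) * c j S).
have kE s S : sign_channel s S = w * p s S by rewrite /sign_channel big_split.
have p_ge s S : 2^-1 <= p s S.
  apply: le_trans (_ : 1 - \sum_j alpha j <= _); first by lra.
  apply: le_trans (prod_1B_ge _ al1) _; apply: ler_prod => j _.
  have /andP [_ h] := al1 j; rewrite subr_ge0 h /=.
  have := c_le j S; rewrite ler_norml => /andP [h1 h2].
  by case: (s j); rewrite ?expr1 ?expr0; lra.
have Zs s : w * (Z / 2) <= \sum_S a S * sign_channel s S.
  rewrite /Z mulr_suml mulr_sumr; apply: ler_sum => S _.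
  by rewrite kE mulrCA ler_wpM2l // ler_wpM2l ?(ltW w0).
have wZ : 0 < w * (Z / 2) by rewrite !mulr_gt0 ?invr_gt0.
apply: le_trans (_ : \sum_s 2 / Z * (w * (\sum_S rho S * p s S) ^+ 2) <= _).
  apply: ler_sum => s _.
  have -> : \sum_S rho S * sign_channel s S = w * \sum_S rho S * p s S.
    by rewrite mulr_sumr; apply: eq_bigr => S _; rewrite kE mulrCA.
  set X := \sum_S rho S * p s S.
  rewrite ler_pdivrMr; last exact: lt_le_trans (Zs s).
  apply: le_trans (_ : 2 / Z * (w * X ^+ 2) * (w * (Z / 2)) <= _).
    by rewrite le_eqVlt; apply/orP; left; apply/eqP; field; rewrite gt_eqF.
  apply: ler_wpM2l; last exact: Zs.
  by rewrite mulr_ge0 ?divr_ge0 ?(ltW Z0) // mulr_ge0 ?sqr_ge0 // ltW.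
rewrite -mulr_sumr; apply: ler_wpM2l; first by rewrite divr_ge0 // ltW.
(* The square brings in a second copy [S']; under fair signs the product of the two densities
   averages to a product over [j], terms linear in a sign cancelling. *)
have -> : \sum_s w * (\sum_S rho S * p s S) ^+ 2 =
    \sum_S \sum_S' rho S * rho S' * \prod_j (1 + c j S * c j S').
  transitivity (\sum_s \sum_S \sum_S' rho S * rho S' * (w * (p s S * p s S'))).
    apply: eq_bigr => s _; rewrite expr2 mulr_suml mulr_sumr.
    apply: eq_bigr => S _; rewrite mulr_sumr mulr_sumr; apply: eq_bigr => S' _.
    by ring.
  rewrite exchange_big; apply: eq_bigr => S _ /=.
  rewrite exchange_big; apply: eq_bigr => S' _ /=.
  rewrite -mulr_sumr; congr (_ * _).
  transitivity (\sum_(s : {ffun J -> bool}) \prod_j (2^-1 *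
      ((1 + (-1) ^+ (s j) * c j S) * (1 + (-1) ^+ (s j) * c j S')))).
    by apply: eq_bigr => s _; rewrite /w /p -!big_split.
  rewrite -(bigA_distr_bigA (fun j (b : bool) => 2^-1 *
      ((1 + (-1) ^+ b * c j S) * (1 + (-1) ^+ b * c j S')))) /=.
  by apply: eq_bigr => j _; rewrite big_bool /= expr0 expr1; field.
(* The term 1 is free since [rho] has total mass 0; the sum now matches the first-order expansion of
   the product. *)
have -> : \sum_j (\sum_S rho S * c j S) ^+ 2 =
    \sum_S \sum_S' rho S * rho S' * (1 + \sum_j c j S * c j S').
  transitivity ((\sum_S rho S) * (\sum_S' rho S') +
      \sum_j (\sum_S rho S * c j S) ^+ 2); first by rewrite rho0 mul0r add0r.
  transitivity (\sum_S \sum_S' (rho S * rho S' +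
      \sum_j rho S * rho S' * (c j S * c j S'))); last first.
    by apply: eq_bigr => S _; apply: eq_bigr => S' _; rewrite mulrDr mulr1 mulr_sumr.
  under [RHS]eq_bigr do rewrite big_split /=.
  rewrite [RHS]big_split /=; congr (_ + _).
    by rewrite mulr_suml; apply: eq_bigr => S _; rewrite mulr_sumr.
  under [RHS]eq_bigr do rewrite exchange_big /=.
  rewrite [RHS]exchange_big /=; apply: eq_bigr => j _.
  rewrite expr2 mulr_suml; apply: eq_bigr => S _; rewrite mulr_sumr.
  by apply: eq_bigr => S' _; ring.
have -> : (\sum_j alpha j ^+ 2) ^+ 2 * (\sum_S `|rho S|) ^+ 2 =
    \sum_S \sum_S' (\sum_j alpha j ^+ 2) ^+ 2 * (`|rho S| * `|rho S'|).
  rewrite [X in _ * X]expr2 mulr_suml mulr_sumr; apply: eq_bigr => S _.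
  by rewrite mulr_sumr mulr_sumr.
rewrite -big_split; apply: ler_sum => S _ /=.
rewrite -big_split; apply: ler_sum => S' _ /=.
rewrite -lerBlDl -mulrBr; apply: le_trans (ler_norm _) _.
rewrite !normrM mulrC ler_wpM2r ?mulr_ge0 // opprD addrA.
have cc : \sum_j `|c j S * c j S'| <= \sum_j alpha j ^+ 2.
  by apply: ler_sum => j _; rewrite normrM expr2 ler_pM.
apply: le_trans (prod_1D_remainder (x := fun j => c j S * c j S') _) _.
  apply: le_trans cc _; apply: le_trans (_ : \sum_j alpha j <= 1); last by lra.
  apply: ler_sum => j _; have /andP [h1 h2] := al1 j.
  by rewrite expr2 ler_piMl.
by rewrite ler_sqr // nnegrE sumr_ge0 // => j _; rewrite ?sqr_ge0.
Qed.

End SignChannel.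

(** * Tilted matroid weights *)

Section EdgeTilt.
Variable R : realType.
Implicit Types (y s : R) (b : bool).

(** The amplitude [a] solving [(1 + a) (1 - a) = exp (- |y|)]. *)
Definition edge_amp y : R := Num.sqrt (1 - expR (- `|y|)).

(** A positive function [k] of two bits is of the form [C exp (x b1 + z b2)] iff
    [k 1 1 * k 0 0 = k 1 0 * k 0 1]. With the signal on unequal bits for [y < 0] and on equal bits
    otherwise, this condition for [exp (y b1 b2) (1 + s m)], [m] being the mean, becomes
    [exp y = 1 - a ^ 2], respectively [exp y (1 - a ^ 2) = 1]. *)
Definition edge_mean y b1 b2 : R :=
  edge_amp y * (if y < 0 then b1%:R - b2%:R else b1%:R + b2%:R - 1).

Lemma edge_amp_ge0 y : 0 <= edge_amp y. Proof. exact: sqrtr_ge0. Qed.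

Lemma edge_amp_sqr y : edge_amp y ^+ 2 = 1 - expR (- `|y|).
Proof. by rewrite sqr_sqrtr // subr_ge0 expR_le1 oppr_le0. Qed.

Lemma edge_amp_sqr_le y : edge_amp y ^+ 2 <= `|y|.
Proof. by rewrite edge_amp_sqr; have := expR_ge1Dx (- `|y|); lra. Qed.

Lemma edge_amp_lt1 y : edge_amp y < 1.
Proof.
rewrite -(@ltr_pXn2r _ 2) ?nnegrE ?edge_amp_ge0 // edge_amp_sqr expr1n.
by have := expR_gt0 (- `|y|); lra.
Qed.

Lemma edge_mean_le y b1 b2 : `|edge_mean y b1 b2| <= edge_amp y.
Proof.
rewrite /edge_mean normrM ger0_norm ?edge_amp_ge0 // -[leRHS]mulr1.
apply: ler_wpM2l; first exact: edge_amp_ge0.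
by case: ifP => _; case: b1; case: b2; rewrite ler_norml /=; lra.
Qed.

(* Conditionally on the sign, the interaction of the edge becomes a field. *)
Lemma edge_tilt y (b : bool) : let s := (-1) ^+ b in
  exists C x z : R, 0 < C /\ forall b1 b2 : bool,
  expR (y * b1%:R * b2%:R) * (2^-1 * (1 + s * edge_mean y b1 b2)) =
  C * expR (x * b1%:R + z * b2%:R).
Proof.
move=> s; have a0 := edge_amp_ge0 y; have a1 := edge_amp_lt1 y.
have a2 := edge_amp_sqr y.
have s2 : s ^+ 2 = 1 by rewrite sqrr_sign.
have sa : `|s * edge_amp y| < 1 by rewrite normrM normr_sign mul1r ger0_norm.
move: sa; rewrite ltr_norml => /andP [sa1 sa2].
rewrite /edge_mean; case: ltP => y0.
  have [p q] : 0 < 1 + s * edge_amp y /\ 0 < 1 - s * edge_amp y by split; lra.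
  have e : expR y = (1 + s * edge_amp y) * (1 - s * edge_amp y).
    rewrite (_ : _ * _ = 1 - s ^+ 2 * edge_amp y ^+ 2); last by ring.
    by rewrite s2 a2 ltr0_norm // opprK; ring.
  exists 2^-1, (ln (1 + s * edge_amp y)), (ln (1 - s * edge_amp y)); split.
    by rewrite invr_gt0.
  case=> [] [] /=; rewrite ?mulr1 ?mulr0 ?expRD ?expR0 ?lnK ?posrE // ?e; ring.
have q : 0 < 1 - s * edge_amp y by lra.
have e : expR y * ((1 + s * edge_amp y) * (1 - s * edge_amp y)) = 1.
  rewrite (_ : (1 + _) * _ = 1 - s ^+ 2 * edge_amp y ^+ 2); last by ring.
  by rewrite s2 a2 ger0_norm // expRN mul1r opprB addrC subrK divff ?gt_eqF ?expR_gt0.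
exists (2^-1 * (1 - s * edge_amp y)), (- ln (1 - s * edge_amp y)),
  (- ln (1 - s * edge_amp y)); split; first by rewrite mulr_gt0 ?invr_gt0.
case=> [] [] /=; rewrite ?mulr1 ?mulr0 ?expRD ?expR0 ?expRN ?lnK ?posrE //.
- transitivity (2^-1 * (expR y * ((1 + s * edge_amp y) * (1 - s * edge_amp y)))
    / (1 - s * edge_amp y)); first by field; rewrite gt_eqF.
  by rewrite e; field; rewrite gt_eqF.
- by field; rewrite gt_eqF.
- by field; rewrite gt_eqF.
- by field.
Qed.

End EdgeTilt.

Lemma sum_pair (R : nmodType) (I J : finType) (F : I * J -> R) :
  \sum_j F j = \sum_e \sum_f F (e, f).
Proof. by rewrite pair_bigA; apply: eq_bigr => -[]. Qed.

(** * Basis weights with a field and a pair interaction *)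

Section Weights.
Variables (R : realType) (N : nat) (B : {set {set 'I_N}}).
Implicit Types (S : {set 'I_N}) (h u : 'I_N -> R).

Definition lin u S : R := \sum_e u e * (e \in S)%:R.

Variable th : 'I_N -> 'I_N -> R.

Definition pair_energy S : R :=
  \sum_e \sum_f th e f * (e \in S)%:R * (f \in S)%:R.

Definition wgt (t : R) h S : R :=
  (S \in B)%:R * expR (lin h S + t * pair_energy S).

Lemma wgt_ge0 t h S : 0 <= wgt t h S.
Proof. by rewrite mulr_ge0 ?expR_ge0. Qed.

Lemma wgt_mass_gt0 t h : (exists S, S \in B) -> 0 < \sum_S wgt t h S.
Proof.
move=> [S SB]; rewrite (bigD1 S) //= ltr_wpDr ?sumr_ge0 //.
  by move=> S' _; exact: wgt_ge0.
by rewrite /wgt SB mul1r expR_gt0.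
Qed.

Definition pair_mean (tau : R) (j : 'I_N * 'I_N) S : R :=
  edge_mean (tau * th j.1 j.2) (j.1 \in S) (j.2 \in S).

(** Bayes' rule: given the signs, the law of [S] is a law at time [t] with another field, to which
    every ordered pair contributes at both ends. Diagonal pairs need no separate treatment, as
    [edge_tilt] holds for all pairs of bits. *)
Lemma wgt_channel (t tau : R) h (s : {ffun 'I_N * 'I_N -> bool}) :
  exists C h', 0 < C /\ forall S,
  wgt (t + tau) h S * sign_channel (pair_mean tau) s S = C * wgt t h' S.
Proof.
have /choice [C HC] : forall j : 'I_N * 'I_N, exists C : R * (R * R), 0 < C.1 /\
    forall b1 b2 : bool, expR (tau * th j.1 j.2 * b1%:R * b2%:R) *
      (2^-1 * (1 + (-1) ^+ (s j) * edge_mean (tau * th j.1 j.2) b1 b2)) =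
    C.1 * expR (C.2.1 * b1%:R + C.2.2 * b2%:R).
  move=> j; have [c [x [z [c0 H]]]] := edge_tilt (tau * th j.1 j.2) (s j).
  by exists (c, (x, z)).
pose h' e := h e + \sum_f (C (e, f)).2.1 + \sum_f (C (f, e)).2.2.
exists (\prod_j (C j).1), h'; split.
  by apply: prodr_gt0 => j _; have [] := HC j.
move=> S; rewrite /wgt -!mulrA mulrCA [RHS]mulrCA [LHS]mulrCA; congr (_ * _).
have -> : lin h S + (t + tau) * pair_energy S = lin h S + t * pair_energy S +
    \sum_(j : 'I_N * 'I_N) tau * th j.1 j.2 * (j.1 \in S)%:R * (j.2 \in S)%:R.
  rewrite mulrDl addrA; congr (_ + _).
  rewrite sum_pair mulr_sumr; apply: eq_bigr => e _; rewrite mulr_sumr.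
  by apply: eq_bigr => f _; rewrite !mulrA.
have -> : lin h' S = lin h S + \sum_(j : 'I_N * 'I_N)
    ((C j).2.1 * (j.1 \in S)%:R + (C j).2.2 * (j.2 \in S)%:R).
  rewrite big_split /= !sum_pair /=.
  rewrite [X in _ + (_ + X)]exchange_big /=.
  rewrite /lin -!big_split; apply: eq_bigr => e _ /=.
  by rewrite /h' !mulrDl !mulr_suml addrA.
rewrite [in RHS]addrAC [in LHS]expRD [in RHS]expRD !expR_sum.
rewrite -mulrA [RHS]mulrCA; congr (_ * _).
by rewrite -!big_split; apply: eq_bigr => j _ /=; have [_ ->] := HC j.
Qed.

End Weights.

(** * Information carried by one round of edge signs *)

Section PairChannel.
Variables (R : realType) (N : nat) (B : {set {set 'I_N}}).
Variables (th : 'I_N -> 'I_N -> R) (Theta tau : R).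
Implicit Types (S : {set 'I_N}) (h u : 'I_N -> R).
Hypothesis thC : forall e f, th e f = th f e.
Hypothesis th_row : forall e, \sum_f `|th e f| <= Theta.
Hypothesis tau_ge0 : 0 <= tau.
Hypothesis tau_small : tau * Theta * N%:R ^+ 4 <= 4^-1.

Local Notation amp j := (edge_amp (tau * th j.1 j.2)).

Lemma amp_sqr_le j : amp j ^+ 2 <= tau * `|th j.1 j.2|.
Proof. by apply: le_trans (edge_amp_sqr_le _) _; rewrite normrM ger0_norm. Qed.

(** Origin of the fourth power: an amplitude is of the order of the square root of the step, so
    [tau_small] makes each of the [N ^ 2] amplitudes at most [1 / (2 N ^ 2)]. *)
Lemma sum_amp_le : \sum_(j : 'I_N * 'I_N) amp j <= 2^-1.
Proof.
have [N0|N0] := posnP N.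
  rewrite big1 ?invr_ge0 // => -[[m hm] f]; exfalso; by move: hm; rewrite N0.
have n0 : 0 < (N%:R : R) ^+ 2 by rewrite exprn_gt0 // ltr0n.
apply: le_trans (_ : \sum_(j : 'I_N * 'I_N) (2^-1 / N%:R ^+ 2) <= _).
  apply: ler_sum => j _; rewrite -(@ler_pXn2r _ 2) //; last 2 first.
  - by rewrite nnegrE edge_amp_ge0.
  - by rewrite nnegrE divr_ge0 // ltW.
  apply: le_trans (amp_sqr_le j) _.
  have h1 : `|th j.1 j.2| <= Theta.
    apply: le_trans (th_row j.1); rewrite (bigD1 j.2) //= lerDl sumr_ge0 //.
  apply: le_trans (ler_wpM2l tau_ge0 h1) _.
  rewrite expr_div_n ler_pdivlMr ?exprn_gt0 ?ltr0n // -exprM.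
  by apply: le_trans tau_small _; rewrite expr2; lra.
rewrite sumr_const card_prod card_ord -[_ *+ (_ * _)]mulr_natr natrM -expr2 divfK //.
by rewrite gt_eqF.
Qed.

Lemma sum_amp_sqr_le : \sum_(j : 'I_N * 'I_N) amp j ^+ 2 <= tau * N%:R * Theta.
Proof.
apply: le_trans (_ : \sum_(j : 'I_N * 'I_N) tau * `|th j.1 j.2| <= _).
  by apply: ler_sum => j _; exact: amp_sqr_le.
rewrite sum_pair /= -mulrA.
under eq_bigr do rewrite -mulr_sumr.
rewrite -mulr_sumr; apply: ler_wpM2l => //.
apply: le_trans (_ : \sum_(e < N) Theta <= _); first exact: ler_sum.
by rewrite sumr_const card_ord mulr_natl.
Qed.

(** The mean of a sign moves by its amplitude times a sum or difference of the shifts [r] at the two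
    ends; the constant in [edge_mean] drops out because [rho] has mass 0. A factor 2 comes from
    [(x + y) ^ 2 <= 2 (x ^ 2 + y ^ 2)], another from using the row sums once per end. *)
Lemma sum_pair_mean_sqr_le (rho : {set 'I_N} -> R) : \sum_S rho S = 0 ->
  \sum_j (\sum_S rho S * pair_mean th tau j S) ^+ 2
  <= 4 * tau * Theta * \sum_e (\sum_S rho S * (e \in S)%:R) ^+ 2.
Proof.
move=> rho0; pose r e := \sum_S rho S * (e \in S)%:R.
have le_j (j : 'I_N * 'I_N) : (\sum_S rho S * pair_mean th tau j S) ^+ 2 <=
    2 * tau * (`|th j.1 j.2| * r j.1 ^+ 2 + `|th j.1 j.2| * r j.2 ^+ 2).
  have [sg sgE ->] : exists2 sg : R, sg ^+ 2 = 1 &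
      \sum_S rho S * pair_mean th tau j S = amp j * (r j.1 + sg * r j.2).
    rewrite /pair_mean /edge_mean; case: (_ < 0).
      exists (-1); first by rewrite sqrrN expr1n.
      rewrite /r mulN1r -sumrB mulr_sumr; apply: eq_bigr => S _ /=; ring.
    exists 1; first by rewrite expr1n.
    transitivity (amp j * (r j.1 + 1 * r j.2 - \sum_S rho S)); last first.
      by rewrite rho0 subr0.
    rewrite /r mul1r -big_split -sumrB mulr_sumr; apply: eq_bigr => S _ /=; ring.
  rewrite exprMn (_ : _ * (_ + _) = tau * `|th j.1 j.2| *
    (2 * (r j.1 ^+ 2 + r j.2 ^+ 2))); last by ring.
  apply: ler_pM; [exact: sqr_ge0|exact: sqr_ge0|exact: amp_sqr_le|].
  rewrite -subr_ge0.
  suff -> : 2 * (r j.1 ^+ 2 + r j.2 ^+ 2) - (r j.1 + sg * r j.2) ^+ 2 =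
    (r j.1 - sg * r j.2) ^+ 2 by exact: sqr_ge0.
  rewrite (_ : (r j.1 - sg * r j.2) ^+ 2 =
    r j.1 ^+ 2 - 2 * sg * r j.1 * r j.2 + sg ^+ 2 * r j.2 ^+ 2); last by ring.
  rewrite (_ : (r j.1 + sg * r j.2) ^+ 2 =
    r j.1 ^+ 2 + 2 * sg * r j.1 * r j.2 + sg ^+ 2 * r j.2 ^+ 2); last by ring.
  rewrite sgE; ring.
apply: le_trans (ler_sum _ (fun j _ => le_j j)) _.
rewrite -mulr_sumr big_split /= !sum_pair /=.
rewrite [X in _ + X]exchange_big /=.
have le_r : \sum_e \sum_f `|th e f| * r e ^+ 2 <= Theta * \sum_e r e ^+ 2.
  rewrite mulr_sumr; apply: ler_sum => e _; rewrite -mulr_suml.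
  by apply: ler_wpM2r; rewrite ?sqr_ge0 ?th_row.
have -> : \sum_j \sum_i `|th i j| * r j ^+ 2 = \sum_e \sum_f `|th e f| * r e ^+ 2.
  by apply: eq_bigr => e _; apply: eq_bigr => f _; rewrite thC.
have := ler_wpM2l tau_ge0 le_r; rewrite -/r; lra.
Qed.

Lemma wgt_channel_chi2 (a rho : {set 'I_N} -> R) :
  (forall S, 0 <= a S) -> 0 < \sum_S a S -> \sum_S rho S = 0 ->
  \sum_s (\sum_S rho S * sign_channel (pair_mean th tau) s S) ^+ 2 /
     (\sum_S a S * sign_channel (pair_mean th tau) s S)
  <= 2 / (\sum_S a S) *
     (4 * tau * Theta * \sum_e (\sum_S rho S * (e \in S)%:R) ^+ 2
       + (tau * N%:R * Theta) ^+ 2 * (\sum_S `|rho S|) ^+ 2).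
Proof.
move=> a0 Z0 rho0.
have amp_le j S : `|pair_mean th tau j S| <= amp j by exact: edge_mean_le.
apply: le_trans (sign_channel_chi2 amp_le sum_amp_le a0 Z0 rho0) _.
apply: ler_wpM2l; first by rewrite divr_ge0 // ltW.
apply: lerD; first exact: sum_pair_mean_sqr_le.
apply: ler_wpM2r; rewrite ?sqr_ge0 // ler_sqr ?nnegrE ?sum_amp_sqr_le //.
  by apply: sumr_ge0 => j _; exact: sqr_ge0.
apply: le_trans sum_amp_sqr_le; apply: sumr_ge0 => j _; exact: sqr_ge0.
Qed.

End PairChannel.

(** * Disintegration of variance and entropy *)

Section Variance.
Variables (R : realType) (T : finType).
Implicit Types (a f : T -> R).

(** The mass times the variance, so that it scales in [a] as [fent] does. *)
Definition fvar a f : R := \sum_i a i * f i ^+ 2 - (\sum_i a i * f i) ^+ 2 / \sum_i a i.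

Lemma fvarZ (C : R) a f : 0 < C -> fvar (fun i => C * a i) f = C * fvar a f.
Proof.
move=> C0; rewrite /fvar mulrBr.
have e G : \sum_i C * a i * G i = C * \sum_i a i * G i.
  by rewrite mulr_sumr; apply: eq_bigr => i _; rewrite mulrA.
rewrite !e -mulr_sumr invfM; set W := (\sum_i a i)^-1.
by field; rewrite gt_eqF.
Qed.

(** A signed measure of total mass 0 that integrates a function to its covariance with [f]; this is
    the [rho] of the chi-square bound. *)
Definition fdev a f i : R := a i * (f i - (\sum_i a i * f i) / \sum_i a i).

Lemma sum_fdev a f : 0 < \sum_i a i -> \sum_i fdev a f i = 0.
Proof.
move=> Z0; rewrite /fdev; set m := _ / _.
transitivity (\sum_i a i * f i - m * \sum_i a i); last first.
  by rewrite /m divfK ?subrr // gt_eqF.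
by rewrite mulr_sumr -sumrB; apply: eq_bigr => i _; ring.
Qed.

Lemma sum_fdev_mul a f (k : T -> R) : \sum_i fdev a f i * k i =
  \sum_i a i * k i * f i - (\sum_i a i * f i) / (\sum_i a i) * \sum_i a i * k i.
Proof.
rewrite /fdev; set m := _ / _.
by rewrite mulr_sumr -sumrB; apply: eq_bigr => i _; ring.
Qed.

Lemma fvarE a f : 0 < \sum_i a i ->
  fvar a f = \sum_i a i * (f i - (\sum_i a i * f i) / \sum_i a i) ^+ 2.
Proof.
move=> Z0; rewrite /fvar; set M := \sum_i a i * f i; set Z := \sum_i a i in Z0 *.
transitivity (\sum_i a i * f i ^+ 2 - 2 * (M / Z) * M + (M / Z) ^+ 2 * Z).
  by field; rewrite gt_eqF.
rewrite [X in _ - X + _]mulr_sumr [X in _ + X]mulr_sumr -sumrB -big_split.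
by apply: eq_bigr => i _ /=; ring.
Qed.

Lemma fdev_l1_le a f : (forall i, 0 <= a i) -> 0 < \sum_i a i ->
  (\sum_i `|fdev a f i|) ^+ 2 <= (\sum_i a i) * fvar a f.
Proof.
move=> a0 Z0; rewrite fvarE // /fdev; set m := _ / _.
have -> : \sum_i `|a i * (f i - m)| = \sum_i a i * 1 * `|f i - m|.
  by apply: eq_bigr => i _; rewrite normrM ger0_norm // mulr1.
apply: le_trans (sum_CauchySchwarz (fun=> 1) (fun i => `|f i - m|) a0) _.
rewrite le_eqVlt; apply/orP; left; apply/eqP; congr (_ * _).
  by apply: eq_bigr => i _; rewrite expr1n mulr1.
by apply: eq_bigr => i _; rewrite real_normK ?num_real.
Qed.

Section Disintegration.
Variables (J : finType) (k : J -> T -> R) (a : T -> R).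
Hypothesis a_ge0 : forall i, 0 <= a i.
Hypothesis k_ge0 : forall s i, 0 <= a i * k s i.
Hypothesis sum_k : forall i, \sum_s k s i = 1.
Hypothesis mass_k : forall s, 0 < \sum_i a i * k s i.
Hypothesis mass : 0 < \sum_i a i.

Lemma sum_disintegrate (g : T -> R) :
  \sum_s \sum_i a i * k s i * g i = \sum_i a i * g i.
Proof.
rewrite exchange_big; apply: eq_bigr => i _ /=.
by rewrite -mulr_suml -mulr_sumr sum_k mulr1.
Qed.

(** Law of total variance: the sum of [fdev a f i * k s i] is the mass of [s] times the shift of the
    conditional mean of [f]. *)
Lemma fvar_disintegrate f :
  fvar a f = \sum_s fvar (fun i => a i * k s i) f
    + \sum_s (\sum_i fdev a f i * k s i) ^+ 2 / \sum_i a i * k s i.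
Proof.
rewrite -big_split /=.
pose m := (\sum_i a i * f i) / \sum_i a i.
pose M s := \sum_i a i * k s i * f i; pose Z s := \sum_i a i * k s i.
transitivity (\sum_s (\sum_i a i * k s i * f i ^+ 2
    - 2 * m * M s + m ^+ 2 * Z s)); last first.
  apply: eq_bigr => s _; rewrite sum_fdev_mul -/m /fvar -/(M s) -/(Z s).
  by field; rewrite gt_eqF // mass_k.
rewrite big_split sumrB /= -!mulr_sumr !sum_disintegrate.
have -> : \sum_s Z s = \sum_i a i.
  rewrite /Z exchange_big; apply: eq_bigr => i _ /=.
  by rewrite -mulr_sumr sum_k mulr1.
by rewrite /fvar /m; field; rewrite gt_eqF.
Qed.

(** Chain rule for the entropy. The part carried by [s] is the relative entropy of its law under
    [a f] with respect to its law under [a]; [ln x <= x - 1] replaces it by a chi-square, the same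
    quantity as in the law of total variance. *)
Lemma fent_disintegrate_le f : (forall i, 0 < f i) ->
  fent a f <= \sum_s fent (fun i => a i * k s i) f
    + (\sum_i a i) / (\sum_i a i * f i) *
      \sum_s (\sum_i fdev a f i * k s i) ^+ 2 / \sum_i a i * k s i.
Proof.
move=> f0; have M0 := sum_mul_gt0 a_ge0 f0 mass.
pose M s := \sum_i a i * k s i * f i; pose Z s := \sum_i a i * k s i.
have Ms s : 0 < M s by apply: sum_mul_gt0.
rewrite (eq_bigr _ (fun s _ => congr1 (fun x => x ^+ 2 / _) (sum_fdev_mul a f (k s)))).
rewrite /fent sumrB !sum_disintegrate -addrA lerD2l addrC -lerBlDr opprK addrC.
set MM := \sum_i a i * f i in M0 *; have ZZ0 := mass; set ZZ := \sum_i a i in ZZ0 *.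
have eM : \sum_s M s = MM by exact: sum_disintegrate.
have eZ : \sum_s Z s = ZZ.
  rewrite /Z exchange_big; apply: eq_bigr => i _ /=.
  by rewrite -mulr_sumr sum_k mulr1.
have H s : M s * ln (M s / Z s) - M s * ln (MM / ZZ) <=
    ZZ / MM * ((M s - MM / ZZ * Z s) ^+ 2 / Z s) + (M s - MM / ZZ * Z s).
  have Zs := mass_k s; have Ms0 := Ms s.
  have p : 0 < M s / Z s / (MM / ZZ) by rewrite !divr_gt0.
  have := ler_wpM2l (ltW Ms0) (ln_le_subr1 p).
  rewrite [ln (_ / (MM / ZZ))]ln_div ?posrE ?divr_gt0 // mulrBr => h.
  apply: le_trans h _; rewrite le_eqVlt; apply/orP; left; apply/eqP.
  by field; rewrite !gt_eqF.
have := ler_sum (index_enum J) (fun s (_ : true) => H s).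
rewrite sumrB big_split /= -[X in _ - X <= _]mulr_suml -[X in _ <= X + _]mulr_sumr.
rewrite sumrB -[X in _ <= _ + (_ - X)]mulr_sumr eM eZ.
by rewrite divfK ?gt_eqF // subrr addr0.
Qed.

End Disintegration.
End Variance.

(** * Covariance and entropy bounds along the interpolation *)

Section FunctionalBounds.
Variables (R : realType) (N : nat) (B : {set {set 'I_N}}).
Variables (th : 'I_N -> 'I_N -> R) (Theta : R).
Implicit Types (S : {set 'I_N}) (h u : 'I_N -> R) (F : {set 'I_N} -> R).
Hypothesis B_neq0 : exists S, S \in B.
Hypothesis thC : forall e f, th e f = th f e.
Hypothesis th_row : forall e, \sum_f `|th e f| <= Theta.
Hypothesis Theta_ge0 : 0 <= Theta.
Hypothesis Theta_le : Theta <= 80^-1.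

Local Notation wt := (wgt B th).

Definition sqnorm u : R := \sum_e u e ^+ 2.

Definition cov_bound (K t : R) := forall h u,
  fvar (wt t h) (lin u) <= K * sqnorm u * \sum_S wt t h S.

(** For the bases of a matroid, [i |: sg] with [i] outside [sg] is a basis only if [sg] has one
    element less than the rank; sets of other sizes contribute 0, so the rank need not appear. *)
Definition links_ent (a F : {set 'I_N} -> R) : R :=
  \sum_(sg : {set 'I_N})
    fent (fun i => (i \notin sg)%:R * a (i |: sg)) (fun i => F (i |: sg)).

Definition ent_bound (C t : R) := forall h F, (forall S, 0 < F S) ->
  fent (wt t h) F <= C * links_ent (wt t h) F.

Lemma sqnorm_ge0 u : 0 <= sqnorm u.
Proof. by apply: sumr_ge0 => e _; exact: sqr_ge0. Qed.

Lemma wt_gt0 t h : 0 < \sum_S wt t h S. Proof. exact: wgt_mass_gt0. Qed.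

Lemma cov_boundW K K' t : K <= K' -> cov_bound K t -> cov_bound K' t.
Proof.
move=> KK' H h u; apply: le_trans (H h u) _; rewrite ler_wpM2r ?(ltW (wt_gt0 t h)) //.
by rewrite ler_wpM2r ?sqnorm_ge0.
Qed.

(** The a priori bound that starts the bootstrap in [cov_bound_improve]. *)
Lemma cov_bound_trivial t : cov_bound N%:R t.
Proof.
move=> h u; rewrite /fvar; apply: le_trans (_ : \sum_S wt t h S * lin u S ^+ 2 <= _).
  by rewrite gerBl divr_ge0 ?sqr_ge0 ?(ltW (wt_gt0 t h)).
rewrite mulr_sumr; apply: ler_sum => S _; rewrite mulrC ler_wpM2r ?wgt_ge0 //.
have := @sum_CauchySchwarz R _ (fun=> 1) u (fun e => (e \in S)%:R) (fun=> ler01).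
have -> : \sum_e 1 * u e * (e \in S)%:R = lin u S.
  by apply: eq_bigr => e _; rewrite mul1r.
have -> : \sum_e 1 * u e ^+ 2 = sqnorm u by apply: eq_bigr => e _; rewrite mul1r.
move=> h1; apply: le_trans h1 _; rewrite mulrC ler_wpM2r ?sqnorm_ge0 //.
apply: le_trans (_ : \sum_(e < N) 1 <= _); last by rewrite sumr_const card_ord.
by apply: ler_sum => e _; rewrite mul1r; case: (_ \in _); rewrite ?expr1n ?expr0n.
Qed.

Lemma lin_dual (r : {set 'I_N} -> R) u : (forall e, u e = \sum_S r S * (e \in S)%:R) ->
  \sum_S r S * lin u S = sqnorm u.
Proof.
move=> uE; rewrite /lin.
transitivity (\sum_S \sum_e r S * (u e * (e \in S)%:R)).
  by apply: eq_bigr => S _; rewrite mulr_sumr.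
rewrite exchange_big; apply: eq_bigr => e _ /=.
by rewrite expr2 [X in _ = _ * X]uE mulr_sumr; apply: eq_bigr => S _; ring.
Qed.

(** Duality: the vector [u] of covariances of [f] with the indicators is tested against itself, so
    that [sqnorm u] is the covariance of [f] and [lin u]; after Cauchy-Schwarz and the bound in
    direction [u], one factor [sqnorm u] cancels. *)
Lemma fdev_sqnorm_le K t h f : 0 <= K -> cov_bound K t ->
  sqnorm (fun e => \sum_S fdev (wt t h) f S * (e \in S)%:R) <=
  K * (\sum_S wt t h S) * fvar (wt t h) f.
Proof.
move=> K0 HK; set u := fun e => _; have a0 := wgt_ge0 B th t h.
have Z0 := wt_gt0 t h; set a := wt t h in a0 Z0 u *.
have uE : \sum_S fdev a f S * lin u S = sqnorm u by exact: lin_dual.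
set mu := (\sum_S a S * lin u S) / \sum_S a S.
have E : sqnorm u = \sum_S a S * (f S - (\sum_S a S * f S) / \sum_S a S) * (lin u S - mu).
  transitivity (\sum_S fdev a f S * lin u S - (\sum_S fdev a f S) * mu).
    by rewrite uE sum_fdev // mul0r subr0.
  rewrite [X in _ - X]mulr_suml -sumrB.
  by apply: eq_bigr => S _; rewrite /fdev; ring.
have := sum_CauchySchwarz (fun S => f S - (\sum_S a S * f S) / \sum_S a S)
  (fun S => lin u S - mu) a0.
rewrite -E -!fvarE // => h1.
have V0 : 0 <= fvar a f.
  by rewrite fvarE //; apply: sumr_ge0 => S _; rewrite mulr_ge0 ?sqr_ge0.
have h2 := le_trans h1 (ler_wpM2l V0 (HK h u)).
have [q0|q0] := eqVneq (sqnorm u) 0.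
  by rewrite q0 !mulr_ge0 // ltW.
have {}q0 : 0 < sqnorm u by rewrite lt_neqAle eq_sym q0 sqnorm_ge0.
by rewrite -(ler_pM2l q0) -expr2; apply: le_trans h2 _; rewrite -/a; lra.
Qed.

End FunctionalBounds.

(** * One step of the interpolation and its iteration *)

Section Interpolation.
Variables (R : realType) (N : nat) (B : {set {set 'I_N}}).
Variables (th : 'I_N -> 'I_N -> R) (Theta : R).
Implicit Types (S : {set 'I_N}) (h u : 'I_N -> R) (F : {set 'I_N} -> R).
Hypothesis N_gt0 : (0 < N)%N.
Hypothesis B_neq0 : exists S, S \in B.
Hypothesis thC : forall e f, th e f = th f e.
Hypothesis th_row : forall e, \sum_f `|th e f| <= Theta.
Hypothesis Theta_ge0 : 0 <= Theta.
Hypothesis Theta_le : Theta <= 80^-1.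

Local Notation wt := (wgt B th).

(** A covariance bound at all fields makes every [lin u] sub-Gaussian, by integration along the
    fields [h + s u]; the variational formula for the entropy turns this into a bound on the shift
    of the means under the density [F]. *)
Lemma tilt_sqnorm_le t h F : cov_bound B th 2 t -> (forall S, 0 < F S) ->
  sqnorm (fun e => \sum_S fdev (wt t h) F S * (e \in S)%:R) <=
  4 * (\sum_S wt t h S * F S) * fent (wt t h) F.
Proof.
move=> HK F0; have a0 := wgt_ge0 B th t h; have Z0 := wgt_mass_gt0 th t h B_neq0.
set r := fun e => _; set a := wt t h in a0 Z0 r *.
have M0 := sum_mul_gt0 a0 F0 Z0; set M := \sum_S a S * F S in M0 *.
have rE : \sum_S fdev a F S * lin r S = sqnorm r by exact: lin_dual.
(* The maximiser of the pairing of [r] with [u] minus [M * sqnorm u], with value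
   [sqnorm r / (4 M)]. *)
pose u e := r e / (2 * M).
have linZ S : lin u S = lin r S / (2 * M).
  by rewrite /lin mulr_suml; apply: eq_bigr => e _; rewrite /u mulrAC.
have sq_u : sqnorm u = sqnorm r / (2 * M) ^+ 2.
  by rewrite /sqnorm mulr_suml; apply: eq_bigr => e _; rewrite /u expr_div_n.
have T := @ln_sum_expR_second_order R _ a (fun S t => t * lin u S)
  (fun S _ => lin u S) (fun S _ => 0) (2 * sqnorm u) a0 Z0.
have wtE s : (fun S => a S * expR (s * lin u S)) = wt t (fun e => h e + s * u e).
  apply/funext => S; rewrite /a /wgt -mulrA -expRD; congr (_ * expR _).
  rewrite addrAC; congr (_ + _); rewrite /lin mulr_sumr -big_split.
  by apply: eq_bigr => e _ /=; ring.
have {}T : ln (\sum_S a S * expR (lin u S)) <=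
    ln (\sum_S a S) + (\sum_S a S * lin u S) / (\sum_S a S) + sqnorm u.
  have e0 S : a S * expR (0 * lin u S) = a S by rewrite mul0r expR0 mulr1.
  have e1 S : a S * expR (1 * lin u S) = a S * expR (lin u S) by rewrite mul1r.
  have e2 : 2 * sqnorm u / 2 = sqnorm u by field.
  have E0 : \sum_S a S * expR (0 * lin u S) = \sum_S a S.
    by apply: eq_bigr => S _; rewrite e0.
  have E1 : \sum_S a S * expR (0 * lin u S) * lin u S = \sum_S a S * lin u S.
    by apply: eq_bigr => S _; rewrite e0.
  have E2 : \sum_S a S * expR (1 * lin u S) = \sum_S a S * expR (lin u S).
    by apply: eq_bigr => S _; rewrite e1.
  move: T; rewrite E0 E1 E2 e2.
  apply.
  - move=> S s _; have h5 : is_derive s 1 (lin u S \*: (@id R)) (lin u S *: 1).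
      exact: is_deriveZ.
    rewrite (_ : (fun _ => _) = lin u S \*: (@id R)); last first.
      by apply/funext => x; rewrite /= /GRing.scale /= mulrC.
    by apply: is_derive_eq; rewrite /GRing.scale /= mulr1.
  - move=> s _; have := HK (fun e => h e + s * u e) u.
    have := wgt_mass_gt0 th t (fun e => h e + s * u e) B_neq0.
    rewrite -wtE /fvar.
    under [X in X * _ - _]eq_bigr do rewrite addr0.
    set X := \sum_S _ * _ ^+ 2; set Y := \sum_S _ * lin u S.
    set Z := \sum_S _ => Zs /(ler_wpM2r (ltW Zs)).
    rewrite mulrBl divfK ?gt_eqF // -[_ * Z * Z]mulrA -expr2; apply: le_trans.
    by rewrite mulrC.
have DV := fent_donsker_varadhan a0 F0 (fun S => expR_gt0 (lin u S)).
have G0 := sum_mul_gt0 a0 (fun S => expR_gt0 (lin u S)) Z0.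
rewrite ln_div ?posrE // in DV.
have E3 : \sum_S a S * (F S * ln (expR (lin u S))) = \sum_S a S * (F S * lin u S).
  by apply: eq_bigr => S _; rewrite expRK.
rewrite E3 -/M in DV.
have {}DV : \sum_S a S * (F S * lin u S) - M * ((\sum_S a S * lin u S) / (\sum_S a S))
    - M * sqnorm u <= fent a F.
  apply: le_trans DV; rewrite -addrA -opprD -mulrDr lerD2l lerN2 ler_wpM2l ?(ltW M0) //.
  by move: T; lra.
have e : \sum_S a S * (F S * lin u S) - M * ((\sum_S a S * lin u S) / (\sum_S a S))
    = sqnorm r / (2 * M).
  have -> : \sum_S a S * (F S * lin u S) = (\sum_S a S * lin r S * F S) / (2 * M).
    by rewrite mulr_suml; apply: eq_bigr => S _; rewrite linZ; ring.
  have -> : \sum_S a S * lin u S = (\sum_S a S * lin r S) / (2 * M).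
    by rewrite mulr_suml; apply: eq_bigr => S _; rewrite linZ; ring.
  by rewrite -rE sum_fdev_mul -/M; field; rewrite !gt_eqF.
have : sqnorm r / (4 * M) <= fent a F.
  apply: le_trans DV; rewrite e sq_u le_eqVlt; apply/orP; left; apply/eqP.
  by field; rewrite gt_eqF.
by rewrite ler_pdivrMr ?mulr_gt0 // mulrC.
Qed.

Section Step.
Variable tau : R.
Hypothesis tau_ge0 : 0 <= tau.
Hypothesis tau_le : tau * N%:R ^+ 4 <= 4^-1.

Local Notation chan := (sign_channel (pair_mean th tau)).

Lemma wgt_channel_pos t h :
  (forall s S, 0 <= wt (t + tau) h S * chan s S) /\
  (forall s, 0 < \sum_S wt (t + tau) h S * chan s S).
Proof.
split=> s; have [C [h' [C0 HC]]] := wgt_channel B th t tau h s.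
  by move=> S; rewrite HC mulr_ge0 ?wgt_ge0 // ltW.
under eq_bigr do rewrite HC.
by rewrite -mulr_sumr mulr_gt0 // wgt_mass_gt0.
Qed.

Lemma tauTheta_small : tau * Theta * N%:R ^+ 4 <= 4^-1.
Proof.
rewrite mulrAC; apply: le_trans (ler_wpM2r Theta_ge0 tau_le) _.
by have := Theta_le; lra.
Qed.

Lemma tauTheta_ge0 : 0 <= tau * Theta. Proof. exact: mulr_ge0. Qed.

(** The step is short enough for the second-order error to be absorbed in the first-order one,
    without a factor depending on [N]. *)
Lemma tauNTheta_sqr_le : (tau * N%:R * Theta) ^+ 2 <= tau * Theta.
Proof.
have -> : (tau * N%:R * Theta) ^+ 2 = tau * Theta * (tau * Theta * N%:R ^+ 2) by ring.
rewrite -[leRHS]mulr1 ler_wpM2l ?tauTheta_ge0 //.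
apply: le_trans (_ : 4^-1 <= _); last lra.
apply: le_trans tauTheta_small; rewrite ler_wpM2l ?tauTheta_ge0 //.
by rewrite -!natrX ler_nat; case: (posnP N) => [->//|N0]; rewrite leq_pexp2l.
Qed.

Lemma tauN_le : tau * N%:R <= 4^-1.
Proof.
apply: le_trans tau_le; rewrite ler_wpM2l //.
by rewrite -natrX ler_nat; case: (posnP N) => [->//|N0]; rewrite -{1}(expn1 N) leq_pexp2l.
Qed.

Lemma tauTheta_le : tau * Theta <= 320^-1.
Proof.
have h : tau <= tau * N%:R ^+ 4.
  by rewrite -[leLHS]mulr1 ler_wpM2l // -natrX ler1n expn_gt0 N_gt0.
by have := ler_wpM2r Theta_ge0 (le_trans h tau_le); have := Theta_le; lra.
Qed.

(** Self-bounding: the variance explained by the signs is at most [d] times the total variance, so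
    it moves to the left-hand side. *)
Lemma cov_bound_step K K' t : 0 <= K' ->
  let d := 8 * (tau * Theta) * K' + 2 * (tau * N%:R * Theta) ^+ 2 in d < 1 ->
  cov_bound B th K t -> cov_bound B th K' (t + tau) ->
  cov_bound B th (K / (1 - d)) (t + tau).
Proof.
move=> K'0 d d1 HK HK' h u.
have a0 := wgt_ge0 B th (t + tau) h.
have Z0 := wgt_mass_gt0 th (t + tau) h B_neq0.
have [k_ge0 mass_k] := wgt_channel_pos t h.
have VD := fvar_disintegrate (sum_sign_channel (pair_mean th tau)) mass_k Z0 (lin u).
have CH := wgt_channel_chi2 thC th_row tau_ge0 tauTheta_small a0 Z0
  (sum_fdev (lin u) Z0).
have l1 := fdev_l1_le (lin u) a0 Z0.
have sq := fdev_sqnorm_le B_neq0 h (lin u) K'0 HK'.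
have VS : \sum_s fvar (fun S => wt (t + tau) h S * chan s S) (lin u) <=
    K * sqnorm u * \sum_S wt (t + tau) h S.
  have -> : \sum_S wt (t + tau) h S = \sum_s \sum_S wt (t + tau) h S * chan s S.
    rewrite exchange_big; apply: eq_bigr => S _ /=.
    by rewrite -mulr_sumr sum_sign_channel mulr1.
  rewrite mulr_sumr; apply: ler_sum => s _.
  have [C [h' [C0 HC]]] := wgt_channel B th t tau h s.
  by rewrite (eq_bigr _ (fun S _ => HC S)) (funext HC) fvarZ // -mulr_sumr mulrCA ler_pM2l.
set a := wt (t + tau) h in a0 Z0 k_ge0 mass_k VD CH l1 sq VS *.
set Z := \sum_S a S in Z0 CH l1 sq VS *.
set V := fvar a (lin u) in VD l1 sq *.
set Q := sqnorm _ in sq; set L := _ ^+ 2 in l1.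
have {}CH : \sum_s (\sum_S fdev a (lin u) S * chan s S) ^+ 2 / \sum_S a S * chan s S
    <= d * V.
  apply: le_trans CH _; rewrite -/L -[\sum_e _]/Q.
  apply: le_trans (_ : 2 / Z * (4 * tau * Theta * (K' * Z * V) +
    (tau * N%:R * Theta) ^+ 2 * (Z * V)) <= _).
    apply: ler_wpM2l; first by rewrite divr_ge0 // ltW.
    apply: lerD; last by apply: ler_wpM2l; rewrite ?sqr_ge0.
    by apply: ler_wpM2l => //; rewrite -mulrA mulr_ge0 ?tauTheta_ge0.
  by rewrite le_eqVlt; apply/orP; left; apply/eqP; rewrite /d; field; rewrite gt_eqF.
have : V * (1 - d) <= K * sqnorm u * Z by move: VD VS CH; lra.
rewrite -ler_pdivlMr ?subr_gt0 // => h1; apply: le_trans h1 _.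
by rewrite le_eqVlt; apply/orP; left; apply/eqP; field; rewrite gt_eqF ?subr_gt0.
Qed.

(** In the first pass, [K' = N] gives [d <= 10 / 320] and hence the bound 4; in the second, [K' = 4]
    gives [d <= 34 tau Theta]. The 40 is kept to match the entropy step. *)
Lemma cov_bound_improve K t : 0 <= K <= 2 -> cov_bound B th K t ->
  cov_bound B th (K / (1 - 40 * (tau * Theta))) (t + tau).
Proof.
move=> /andP [K0 K2] HK; have q := tauNTheta_sqr_le; have p := tauTheta_ge0.
have N0 : 0 <= (N%:R : R) by [].
have tN := ler_wpM2r Theta_ge0 tauN_le; have tT := tauTheta_le.
have tNT : tau * Theta * N%:R <= 320^-1.
  by rewrite mulrAC; have := Theta_le; lra.
set q2 := (_ ^+ 2) in q.
have q0 : 0 <= q2 by exact: sqr_ge0.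
have H1 := cov_bound_step N0 _ HK (cov_bound_trivial th B_neq0 (t + tau)).
rewrite -/q2 in H1.
have {}H1 : cov_bound B th 4 (t + tau).
  apply: (cov_boundW B_neq0 _ (H1 _)); last lra.
  by rewrite ler_pdivrMr; lra.
have H2 := cov_bound_step _ _ HK H1; rewrite -/q2 in H2.
apply: (cov_boundW B_neq0 _ (H2 _ _)); [|by lra|by lra].
by apply: ler_wpM2l => //; rewrite lef_pV2 ?posrE; lra.
Qed.

Lemma ent_bound_step C t : 0 <= C -> cov_bound B th 2 (t + tau) ->
  ent_bound B th C t -> ent_bound B th (C / (1 - 40 * (tau * Theta))) (t + tau).
Proof.
move=> C0 HK HC h F F0.
have a0 := wgt_ge0 B th (t + tau) h.
have Z0 := wgt_mass_gt0 th (t + tau) h B_neq0.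
have [k_ge0 mass_k] := wgt_channel_pos t h.
have ED := fent_disintegrate_le a0 k_ge0 (sum_sign_channel (pair_mean th tau))
  mass_k Z0 F0.
have CH := wgt_channel_chi2 thC th_row tau_ge0 tauTheta_small a0 Z0 (sum_fdev F Z0).
have l1 := fent_pinsker a0 F0.
have sq := tilt_sqnorm_le h HK F0.
have M0 := sum_mul_gt0 a0 F0 Z0.
have ES : \sum_s fent (fun S => wt (t + tau) h S * chan s S) F <=
    C * links_ent (wt (t + tau) h) F.
  apply: le_trans (_ : \sum_s C * links_ent (fun S => wt (t + tau) h S * chan s S) F <= _).
    apply: ler_sum => s _.
    have [c [h' [c0 /funext ->]]] := wgt_channel B th t tau h s.
    rewrite fentZ //; have -> : links_ent (fun S => c * wt t h' S) F = c * links_ent (wt t h') F.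
      rewrite /links_ent mulr_sumr; apply: eq_bigr => sg _.
      by rewrite -fentZ //; apply: eq_fent => i; rewrite mulrCA.
    by rewrite mulrCA ler_pM2l // HC.
  rewrite -mulr_sumr ler_wpM2l // /links_ent exchange_big; apply: ler_sum => sg _ /=.
  apply: le_trans (fent_superadditive _ _) _ => //.
    by move=> s i; rewrite mulr_ge0.
  rewrite le_eqVlt; apply/orP; left; apply/eqP; apply: eq_fent => i.
  by rewrite -!mulr_sumr sum_sign_channel mulr1.
set a := wt (t + tau) h in a0 Z0 k_ge0 mass_k ED CH l1 sq ES M0 *.
set Z := \sum_S a S in Z0 CH ED l1 *.
set M := \sum_S a S * F S in M0 ED l1 sq.
set E := fent a F in ED l1 sq *.
have E0 : 0 <= E by exact: fent_ge0.
set Q := sqnorm _ in sq.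
have {}l1 : (\sum_S `|fdev a F S|) ^+ 2 <= 4 * M * E.
  apply: le_trans l1; rewrite le_eqVlt; apply/orP; left; apply/eqP; congr (_ ^+ 2).
  by apply: eq_bigr => S _; rewrite /fdev normrM ger0_norm.
have q := tauNTheta_sqr_le; have p := tauTheta_ge0.
(* [40 = 2 (4 * 4 + 4)]: the 2 is from the chi-square bound, [4 * 4] from the shifts of the means
   via [tilt_sqnorm_le], the last 4 from Pinsker. *)
have {}CH : Z / M * (\sum_s (\sum_S fdev a F S * chan s S) ^+ 2 /
    \sum_S a S * chan s S) <= 40 * (tau * Theta) * E.
  apply: le_trans (_ : Z / M * (2 / Z * (4 * (tau * Theta) * (4 * M * E) +
    tau * Theta * (4 * M * E))) <= _).
    apply: ler_wpM2l; first by rewrite divr_ge0 // ltW.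
    apply: le_trans CH _; apply: ler_wpM2l; first by rewrite divr_ge0 // ltW.
    apply: lerD.
      rewrite -[\sum_e _]/Q -[4 * tau * _]mulrA; apply: ler_wpM2l => //.
      by rewrite mulr_ge0.
    by apply: ler_pM; rewrite ?sqr_ge0.
  by rewrite le_eqVlt; apply/orP; left; apply/eqP; field; rewrite !gt_eqF.
have d1 : 0 < 1 - 40 * (tau * Theta) by have := tauTheta_le; lra.
have : E * (1 - 40 * (tau * Theta)) <= C * links_ent a F by lra.
by rewrite -ler_pdivlMr // mulrAC.
Qed.
End Step.

Lemma bounds_iterate m k : (0 < m)%N -> (N ^ 4 * 4 <= m)%N -> (k <= m)%N ->
  cov_bound B th 1 0 -> ent_bound B th 1 0 ->
  let C := (1 - 40 * (k%:R / m%:R * Theta))^-1 in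
  cov_bound B th C (k%:R / m%:R) /\ ent_bound B th C (k%:R / m%:R).
Proof.
move=> m0 Nm km H0 E0; elim: k km => [|k IH] km.
  by rewrite /= !mul0r mulr0 subr0 invr1.
have [HK HE] := IH (ltnW km).
have mp : 0 < (m%:R : R) by rewrite ltr0n.
have tau0 : 0 <= (m%:R : R)^-1 by rewrite invr_ge0.
have tau1 : (m%:R : R)^-1 * N%:R ^+ 4 <= 4^-1.
  rewrite mulrC ler_pdivrMr // mulrC ler_pdivlMr // -natrX -natrM ler_nat //.
have km1 : k.+1%:R / m%:R <= 1 :> R by rewrite ler_pdivrMr // mul1r ler_nat.
have e1 : k.+1%:R / m%:R = k%:R / m%:R + m%:R^-1 :> R by rewrite -natr1 mulrDl mul1r.
set x := k%:R / m%:R in HK HE e1 *.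
have x0 : 0 <= x by rewrite divr_ge0.
have y0 := mulr_ge0 tau0 Theta_ge0; have z0 := mulr_ge0 x0 Theta_ge0.
rewrite e1 in km1 *.
have w : (x + m%:R^-1) * Theta <= 80^-1.
  by have := ler_wpM2r Theta_ge0 km1; rewrite mul1r => h; apply: le_trans h _.
rewrite mulrDl in w *.
set X := x * Theta in z0 w HK HE *; set Y := m%:R^-1 * Theta in y0 w *.
have p1 : 0 < 1 - 40 * X by lra.
have p2 : 0 < 1 - 40 * Y by lra.
have p3 : 0 < 1 - 40 * (X + Y) by lra.
(* Losses compose through [(1 - x) (1 - y) >= 1 - (x + y)] for nonnegative [x] and [y]. *)
have le1 : (1 - 40 * X)^-1 / (1 - 40 * Y) <= (1 - 40 * (X + Y))^-1.
  rewrite -invfM lef_pV2 ?posrE ?mulr_gt0 //.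
  by have := mulr_ge0 y0 z0; lra.
(* Here [Theta <= 1 / 80] is spent: the covariance bound never exceeds 2, which the next step
   requires. *)
have c1 : 0 <= (1 - 40 * X)^-1 <= 2.
  rewrite invr_ge0 ltW //= -[2]invrK lef_pV2 ?posrE //; lra.
have K1 := cov_boundW B_neq0 le1 (cov_bound_improve tau0 tau1 c1 HK).
split=> //.
have K2 : cov_bound B th 2 (x + m%:R^-1).
  apply: (cov_boundW B_neq0 _ K1); rewrite -[2]invrK lef_pV2 ?posrE //; lra.
have c0 : 0 <= (1 - 40 * X)^-1 by case/andP: c1.
have E1 := ent_bound_step tau0 tau1 c0 K2 HE.
move=> h F F0; apply: le_trans (E1 h F F0) _; apply: ler_wpM2r => //.
apply: sumr_ge0 => sg _; apply: fent_ge0 => // i.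
by rewrite mulr_ge0 ?wgt_ge0.
Qed.

Lemma ent_bound_of_base : cov_bound B th 1 0 -> ent_bound B th 1 0 ->
  ent_bound B th 2 1.
Proof.
move=> H0 E0; set m := (N ^ 4 * 4)%N.
have m0 : (0 < m)%N by rewrite muln_gt0 expn_gt0 N_gt0.
have [_] := bounds_iterate m0 (leqnn m) (leqnn m) H0 E0.
rewrite divff ?gt_eqF ?ltr0n // mul1r => H h F F0.
apply: le_trans (H h F F0) _; apply: ler_wpM2r.
  apply: sumr_ge0 => sg _; apply: fent_ge0 => // i.
  by rewrite mulr_ge0 ?wgt_ge0.
rewrite -[2]invrK lef_pV2 ?posrE //; have := Theta_le; lra.
Qed.

End Interpolation.

(** * Trickle-down for weighted graphs *)

Section Trickle.
Variables (R : realType) (N : nat).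
Implicit Types (u v : 'I_N -> R).

Lemma continuous_finsum (T : topologicalType) (I : finType) (f : I -> T -> R) :
  (forall i, continuous (f i)) -> continuous (fun x => \sum_i f i x).
Proof.
move=> H; elim: (index_enum I) => [|i s IH].
  rewrite (_ : (fun _ => _) = cst 0); last by apply/funext => t; rewrite big_nil.
  exact: cst_continuous.
rewrite (_ : (fun _ => _) = (fun x => f i x + \sum_(j <- s) f j x)).
  by move=> x; apply: cvgD; [exact: H|exact: IH].
by apply/funext => t; rewrite big_cons.
Qed.

Lemma continuous_mul (T : topologicalType) (f g : T -> R) :
  continuous f -> continuous g -> continuous (fun x => f x * g x).
Proof. by move=> cf cg x; exact: (@continuousM _ _ f g x (cf x) (cg x)). Qed.

(** Extreme values on an ellipsoid cut by a hyperplane: [q > 0] makes it compact, [u0] nonempty. *)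
Lemma quadratic_max (A : 'I_N -> 'I_N -> R) (p q : 'I_N -> R) u0 :
  (forall e, 0 < q e) -> \sum_e q e * u0 e ^+ 2 = 1 -> \sum_e p e * u0 e = 0 ->
  exists u, [/\ \sum_e q e * u e ^+ 2 = 1, \sum_e p e * u e = 0 &
    forall v, \sum_e q e * v e ^+ 2 = 1 -> \sum_e p e * v e = 0 ->
    \sum_e \sum_f A e f * v e * v f <= \sum_e \sum_f A e f * u e * u f].
Proof.
move=> q0 u01 u0p.
have cc e : continuous (fun x : 'rV[R]_N => x 0 e) by exact: coord_continuous.
pose g1 (x : 'rV[R]_N) := \sum_e q e * x 0 e ^+ 2.
pose g2 (x : 'rV[R]_N) := \sum_e p e * x 0 e.
pose g3 (x : 'rV[R]_N) := \sum_e \sum_f A e f * x 0 e * x 0 f.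
have ck (k : R) : continuous (fun _ : 'rV[R]_N => k) by exact: cst_continuous.
have c1 : continuous g1.
  apply: continuous_finsum => e; apply: (continuous_mul (ck _)).
  exact: (continuous_mul (cc e) (cc e)).
have c2 : continuous g2.
  by apply: continuous_finsum => e; exact: (continuous_mul (ck _) (cc e)).
have c3 : continuous g3.
  apply: continuous_finsum => e; apply: continuous_finsum => f.
  exact: (continuous_mul (continuous_mul (ck _) (cc e)) (cc f)).
pose K := ((g1 @^-1` [set 1]) `&` (g2 @^-1` [set 0]))%classic.
have clK : closed K.
  apply: closedI; apply: preimage_closed => [x _|]; try exact: closed_eq.
    exact: c1.
  exact: c2.
have cK : compact K.
  pose M e := 1 + (q e)^-1.
  apply: (@subclosed_compact _ _
    [set x : 'rV[R]_N | forall e, `[- M e, M e]%classic (x 0 e)]%classic) => //.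
    apply: (@rV_compact R N (fun e => `[- M e, M e]%classic)) => e.
    exact: (@segment_compact R).
  move=> x [x1 _] e /=; rewrite in_itv /= -ler_norml.
  have qx : q e * x 0 e ^+ 2 <= 1.
    rewrite -x1 /g1 (bigD1 e) //= lerDl; apply: sumr_ge0 => f _.
    by rewrite mulr_ge0 ?sqr_ge0 // ltW.
  have qi : 0 < (q e)^-1 by rewrite invr_gt0.
  rewrite -(@ler_pXn2r _ 2) ?nnegrE //; last by rewrite /M; lra.
  rewrite real_normK ?num_real //.
  have : x 0 e ^+ 2 <= (q e)^-1 by rewrite -[leRHS]mul1r ler_pdivlMr // mulrC.
  by rewrite /M; nra.
have K0 : (K !=set0)%classic.
  exists (\row_e u0 e); split => /=.
    by apply: etrans u01; apply: eq_bigr => e _; rewrite mxE.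
  by apply: etrans u0p; apply: eq_bigr => e _; rewrite mxE.
have [x] := compact_EVT_max K0 cK (continuous_subspaceT c3).
rewrite inE => -[x1 x2] Hx; exists (fun e => x 0 e); split => // v v1 v2.
have := Hx (\row_e v e); rewrite inE /g3.
have -> : \sum_e \sum_f A e f * (\row_e v e) 0 e * (\row_e v e) 0 f =
    \sum_e \sum_f A e f * v e * v f.
  by apply: eq_bigr => e _; apply: eq_bigr => f _; rewrite !mxE.
apply; split => /=.
  by apply: etrans v1; apply: eq_bigr => e _; rewrite mxE.
by apply: etrans v2; apply: eq_bigr => e _; rewrite mxE.
Qed.

Variables (A : 'I_N -> 'I_N -> R) (p : 'I_N -> R) (c : R).
Hypothesis AC : forall e f, A e f = A f e.
Hypothesis A_ge0 : forall e f, 0 <= A e f.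
Hypothesis p_ge0 : forall e, 0 <= p e.
Hypothesis c_gt0 : 0 < c.
Hypothesis A_row : forall e, \sum_f A e f = c * p e.
Hypothesis A_connected : forall u, (forall e f, 0 < A e f -> u e = u f) ->
  forall e f, 0 < p e -> 0 < p f -> u e = u f.
Hypothesis A_local : forall u, (forall e, p e = 0 -> u e = 0) ->
  c * (\sum_e \sum_f A e f * u e * u f) <= \sum_e (\sum_f A e f * u f) ^+ 2 / p e.

Local Notation form u v := (\sum_e \sum_f A e f * u e * v f).

Lemma weight_eq0 e f : p e = 0 -> A e f = 0.
Proof.
move=> pe; have /eqP := A_row e; rewrite pe mulr0 psumr_eq0 //.
by move=> /allP/(_ f (mem_index_enum f))/eqP.
Qed.

Lemma form_sum1 u : form u (fun=> 1) = c * \sum_e p e * u e.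
Proof.
rewrite mulr_sumr; apply: eq_bigr => e _.
under eq_bigr do rewrite mulr1.
by rewrite -mulr_suml A_row mulrA.
Qed.

Lemma formD_line u v (t : R) : form (fun e => u e + t * v e) (fun e => u e + t * v e) =
  form u u + 2 * t * form u v + t ^+ 2 * form v v.
Proof.
have -> : form u v = (form u v + form v u) / 2.
  have -> : form v u = form u v.
    rewrite exchange_big; apply: eq_bigr => e _; apply: eq_bigr => f _ /=.
    by rewrite AC mulrAC.
  by field.
transitivity (form u u + t * (form u v + form v u) + t ^+ 2 * form v v); last by field.
rewrite -big_split !mulr_sumr -!big_split; apply: eq_bigr => e _ /=.
rewrite -big_split !mulr_sumr -!big_split; apply: eq_bigr => f _ /=.
ring.
Qed.

Lemma line_coef_eq0 (b d : R) : (forall t : R, 0 <= b * t + d * t ^+ 2) -> b = 0.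
Proof.
move=> H; pose D := 1 + `|d|.
have D0 : 0 < D by rewrite /D; have := normr_ge0 d; lra.
have dD : d <= D by have := ler_norm d; rewrite /D; lra.
have h := H (- b / (2 * D)).
have h2 : b * (- b / (2 * D)) + D * (- b / (2 * D)) ^+ 2 = - (b ^+ 2 / (4 * D)).
  by field; rewrite gt_eqF.
have : 0 <= - (b ^+ 2 / (4 * D)).
  by rewrite -h2; apply: le_trans h _; rewrite lerD2l ler_wpM2r ?sqr_ge0.
rewrite oppr_ge0 pmulr_lle0 ?invr_gt0 ?mulr_gt0 // => h3.
by apply/eqP; rewrite -sqrf_eq0 eq_le h3 sqr_ge0.
Qed.

(* On [\sum_e p e * u e = 0] a maximiser of the form with value [lam > 0] is an
   eigenvector; [A_local] then gives [lam >= c], whereas [c] is the top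
   eigenvalue, simple by connectedness. *)
Lemma trickle_mean0 v : \sum_e p e * v e = 0 -> form v v <= 0.
Proof.
move=> vp; rewrite leNgt; apply/negP => v_gt0.
(* Rows of [A] vanish where [p] does; the weight 1 there keeps the constraint set compact, and the
   maximiser will turn out to vanish at these vertices. *)
pose q e := if p e == 0 then 1 else p e.
have q0 e : 0 < q e.
  by rewrite /q; case: eqVneq => // pe; rewrite lt_neqAle eq_sym pe p_ge0.
have qv0 : 0 < \sum_e q e * v e ^+ 2.
  rewrite lt_neqAle sumr_ge0 ?andbT; last first.
    by move=> e _; rewrite mulr_ge0 ?sqr_ge0 // ltW.
  apply/negP => /eqP/esym/eqP; rewrite psumr_eq0; last first.
    by move=> e _; rewrite mulr_ge0 ?sqr_ge0 // ltW.
  move=> /allP H; move: v_gt0; rewrite big1 ?ltxx // => e _; apply: big1 => f _.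
  have := H e (mem_index_enum e); rewrite mulf_eq0 gt_eqF //= expf_eq0 /=.
  by move=> /eqP ->; rewrite mulr0 mul0r.
pose s := (Num.sqrt (\sum_e q e * v e ^+ 2))^-1.
have s2 : s ^+ 2 * (\sum_e q e * v e ^+ 2) = 1.
  by rewrite exprVn sqr_sqrtr ?ltW // mulVf ?gt_eqF.
have scale_q (w : 'I_N -> R) (r : R) :
    \sum_e q e * (r * w e) ^+ 2 = r ^+ 2 * \sum_e q e * w e ^+ 2.
  by rewrite mulr_sumr; apply: eq_bigr => e _; ring.
have scale_p (w : 'I_N -> R) (r : R) :
    \sum_e p e * (r * w e) = r * \sum_e p e * w e.
  by rewrite mulr_sumr; apply: eq_bigr => e _; ring.
have scale_A (w : 'I_N -> R) (r : R) : form (fun e => r * w e) (fun e => r * w e)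
    = r ^+ 2 * form w w.
  rewrite mulr_sumr; apply: eq_bigr => e _; rewrite mulr_sumr.
  by apply: eq_bigr => f _; ring.
have [||u [uq up umax]] := @quadratic_max A p q (fun e => s * v e) q0.
- by rewrite scale_q.
- by rewrite scale_p vp mulr0.
set lam := form u u in umax.
have lam0 : 0 < lam.
  apply: lt_le_trans (umax (fun e => s * v e) _ _); rewrite ?scale_q ?scale_p ?vp ?mulr0 //.
  rewrite scale_A mulr_gt0 // exprn_gt0 // invr_gt0 sqrtr_gt0 //.
have max_all w : \sum_e p e * w e = 0 -> form w w <= lam * \sum_e q e * w e ^+ 2.
  move=> wp; have W0 : 0 <= \sum_e q e * w e ^+ 2.
    by apply: sumr_ge0 => e _; rewrite mulr_ge0 ?sqr_ge0 // ltW.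
  have [W00|Wn0] := eqVneq (\sum_e q e * w e ^+ 2) 0.
    rewrite W00 mulr0 big1 // => e _; apply: big1 => f _.
    move/eqP: W00; rewrite psumr_eq0; last first.
      by move=> e' _; rewrite mulr_ge0 ?sqr_ge0 // ltW.
    move=> /allP/(_ e (mem_index_enum e)); rewrite mulf_eq0 gt_eqF //= expf_eq0 /=.
    by move=> /eqP ->; rewrite mulr0 mul0r.
  have Wp : 0 < \sum_e q e * w e ^+ 2 by rewrite lt_neqAle eq_sym Wn0.
  pose r := (Num.sqrt (\sum_e q e * w e ^+ 2))^-1.
  have r2 : r ^+ 2 = (\sum_e q e * w e ^+ 2)^-1 by rewrite exprVn sqr_sqrtr.
  have := umax (fun e => r * w e); rewrite scale_q scale_p scale_A wp mulr0 r2.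
  by rewrite mulVf // => /(_ erefl erefl); rewrite ler_pdivrMl // mulrC.
have stat w : \sum_e p e * w e = 0 ->
    form u w = lam * \sum_e q e * u e * w e.
  move=> wp; have b0 : 2 * (lam * (\sum_e q e * u e * w e) - form u w) = 0.
    apply: (@line_coef_eq0 _ (lam * (\sum_e q e * w e ^+ 2) - form w w)) => t.
    have := max_all (fun e => u e + t * w e); rewrite formD_line -/lam.
    have -> : \sum_e q e * (u e + t * w e) ^+ 2 = 1 +
        2 * t * (\sum_e q e * u e * w e) + t ^+ 2 * \sum_e q e * w e ^+ 2.
      transitivity (\sum_e q e * u e ^+ 2 +
        2 * t * (\sum_e q e * u e * w e) + t ^+ 2 * \sum_e q e * w e ^+ 2).
        by rewrite !mulr_sumr -!big_split; apply: eq_bigr => e _ /=; ring.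
      by rewrite uq.
    have -> : \sum_e p e * (u e + t * w e) = 0.
      transitivity (\sum_e p e * u e + t * \sum_e p e * w e); last by rewrite up wp mulr0 addr0.
      by rewrite mulr_sumr -big_split; apply: eq_bigr => e _ /=; ring.
    by move=> /(_ erefl); lra.
  lra.
have u_zero e : p e = 0 -> u e = 0.
  move=> pe; have := stat (fun f => (f == e)%:R).
  have delta (k : 'I_N -> R) : \sum_f k f * (f == e)%:R = k e.
    rewrite (bigD1 e) //= eqxx mulr1 big1 ?addr0 // => f /negbTE ->.
    by rewrite mulr0.
  rewrite !delta => /(_ pe).
  under eq_bigr do rewrite delta AC (weight_eq0 _ pe) mul0r.
  rewrite big1 // => /esym/eqP.
  rewrite !mulf_eq0 (gt_eqF lam0) (gt_eqF (q0 e)) /=.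
  by move=> /eqP.
have qu e : q e * u e = p e * u e.
  by rewrite /q; case: eqVneq => // pe; rewrite u_zero ?mulr0.
have up2 : \sum_e p e * u e ^+ 2 = 1.
  by apply: etrans uq; apply: eq_bigr => e _; rewrite !expr2 !mulrA qu.
have P0 : 0 < \sum_e p e.
  rewrite lt_neqAle sumr_ge0 ?andbT //; apply/negP => /eqP/esym/eqP.
  rewrite psumr_eq0 // => /allP H; have := oner_neq0 R; rewrite -up2 big1 ?eqxx // => e _.
  by have /eqP -> := H e (mem_index_enum e); rewrite mul0r.
have eig e : \sum_f A e f * u f = lam * (p e * u e).
  (* Stationarity is known for mean-zero directions only, so a constant is subtracted from the unit
     vector at [e]; it pairs to 0 with [u]. *)
  pose m := p e / \sum_e p e; pose w f := (f == e)%:R - m.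
  have wp : \sum_f p f * w f = 0.
    transitivity (\sum_f p f * (f == e)%:R - m * \sum_f p f).
      by rewrite mulr_sumr -sumrB; apply: eq_bigr => f _; rewrite /w; ring.
    rewrite /m divfK ?gt_eqF // (bigD1 e) //= eqxx mulr1 big1 ?addr0 ?subrr // => f.
    by move=> /negbTE ->; rewrite mulr0.
  have := stat w wp.
  have -> : \sum_f q f * u f * w f = p e * u e.
    transitivity (\sum_f p f * u f * (f == e)%:R - m * \sum_f p f * u f).
      by rewrite mulr_sumr -sumrB; apply: eq_bigr => f _; rewrite qu /w; ring.
    rewrite up mulr0 subr0 (bigD1 e) //= eqxx mulr1 big1 ?addr0 // => f.
    by move=> /negbTE ->; rewrite mulr0.
  move=> <-.
  transitivity (\sum_f A e f * u f - m * form u (fun=> 1)).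
    by rewrite form_sum1 up !mulr0 subr0.
  have -> : \sum_f A e f * u f = \sum_e' \sum_f A e' f * u e' * (f == e)%:R.
    apply: eq_bigr => f _; rewrite (bigD1 e) //= eqxx mulr1 big1 ?addr0; last first.
      by move=> g /negbTE ->; rewrite mulr0.
    by rewrite AC.
  rewrite mulr_sumr -sumrB; apply: eq_bigr => g _.
  by rewrite mulr_sumr -sumrB; apply: eq_bigr => f _; rewrite /w; ring.
have lam_c : c <= lam.
  have := A_local u_zero; rewrite -/lam.
  have -> : \sum_e (\sum_f A e f * u f) ^+ 2 / p e = lam * lam.
    rewrite -[RHS]mulr1 -[X in _ = _ * X]up2 mulr_sumr; apply: eq_bigr => e _; rewrite eig.
    have [pe|pe] := eqVneq (p e) 0; first by rewrite pe u_zero //; ring.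
    by field.
  by rewrite ler_pM2r.
have A_u e f : 0 < A e f -> u e = u f.
  move=> Aef; apply/eqP; rewrite -subr_eq0 -sqrf_eq0.
  (* The Dirichlet form of the graph is nonnegative, whereas [c - lam <= 0]; hence [u] is constant
     along edges, and being of mean 0 it must vanish. *)
  have : \sum_e \sum_f A e f * (u e - u f) ^+ 2 = 2 * (c - lam).
    transitivity (form (fun e => u e ^+ 2) (fun=> 1) + form (fun=> 1) (fun e => u e ^+ 2)
       - 2 * form u u).
      rewrite mulr_sumr -big_split -sumrB; apply: eq_bigr => g _ /=.
      rewrite mulr_sumr -big_split -sumrB; apply: eq_bigr => k _ /=; ring.
    have -> : form (fun=> 1) (fun e => u e ^+ 2) = form (fun e => u e ^+ 2) (fun=> 1).
      rewrite exchange_big; apply: eq_bigr => g _; apply: eq_bigr => k _ /=.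
      by rewrite AC mulrAC.
    by rewrite form_sum1 up2 -/lam; ring.
  move=> Hs; have S0 : \sum_e \sum_f A e f * (u e - u f) ^+ 2 == 0.
    rewrite eq_le {1}Hs; apply/andP; split; first lra.
    by apply: sumr_ge0 => g _; apply: sumr_ge0 => k _; rewrite mulr_ge0 ?sqr_ge0.
  move: S0; rewrite psumr_eq0; last first.
    by move=> g _; apply: sumr_ge0 => k _; rewrite mulr_ge0 ?sqr_ge0.
  move=> /allP/(_ e (mem_index_enum e)) /=; rewrite psumr_eq0; last first.
    by move=> k _; rewrite mulr_ge0 ?sqr_ge0.
  by move=> /allP/(_ f (mem_index_enum f)) /=; rewrite mulf_eq0 gt_eqF.
have conn := A_connected A_u.
have u0 e : u e = 0.
  have [/u_zero //|pe] := eqVneq (p e) 0.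
  have pe0 : 0 < p e by rewrite lt_neqAle eq_sym pe p_ge0.
  have : (\sum_f p f) * u e = 0.
    apply: etrans up; rewrite mulr_suml; apply: eq_bigr => f _.
    have [->|pf] := eqVneq (p f) 0; first by rewrite !mul0r.
    by rewrite (conn e f) // lt_neqAle eq_sym pf p_ge0.
  by move=> /eqP; rewrite mulf_eq0 gt_eqF //= => /eqP.
have := oner_neq0 R; rewrite -up2 big1 ?eqxx // => e _; by rewrite u0 expr0n mulr0.
Qed.

(** The mean-zero case for [u] minus its [p]-mean; the cross terms are explicit since [A] maps
    constants to multiples of [p]. *)
Lemma trickle_down u : (\sum_e p e) * form u u <= c * (\sum_e p e * u e) ^+ 2.
Proof.
have [P0|Pn0] := eqVneq (\sum_e p e) 0.
  by rewrite P0 mul0r mulr_ge0 ?sqr_ge0 // ltW.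
have Pp : 0 < \sum_e p e by rewrite lt_neqAle eq_sym Pn0 sumr_ge0.
set P := \sum_e p e in Pn0 Pp *; set L := \sum_e p e * u e.
pose m := L / P; pose v e := u e + (- m) * 1.
have vp : \sum_e p e * v e = 0.
  transitivity (L - m * P); last by rewrite /m divfK ?subrr.
  by rewrite /L /P mulr_sumr -sumrB; apply: eq_bigr => e _; rewrite /v; ring.
have := trickle_mean0 vp; rewrite formD_line !form_sum1 -/L.
have -> : \sum_e p e * 1 = P by apply: eq_bigr => e _; rewrite mulr1.
move=> h; have := ler_wpM2l (ltW Pp) h; rewrite mulr0.
have -> : P * (form u u + 2 * - m * (c * L) + (- m) ^+ 2 * (c * P)) =
  P * form u u - c * L ^+ 2 by rewrite /m; field.
by rewrite subr_le0.
Qed.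
End Trickle.

(** * Matroid bases *)

Section Matroid.
Variables (N : nat) (B : {set {set 'I_N}}).
Hypothesis HB : is_matroid_bases B.
Implicit Types A S X : {set 'I_N}.

Lemma exchange_card A a b : a \in A -> b \notin A ->
  #|(A :\ a) :|: [set b]| = #|A|.
Proof.
move=> aA bA; rewrite finset.setUC cardsU1 in_setD1 (negbTE bA) andbF /=.
by rewrite (cardsD1 a A) aA.
Qed.

(** Each exchange brings [A] closer to [A'] without changing its size. *)
Lemma bases_card A A' : A \in B -> A' \in B -> #|A| = #|A'|.
Proof.
have [_ ex] := HB.
move: {2}#|A :\: A'|.+1 (ltnSn #|A :\: A'|) => n; elim: n A => // n IH A lt AB AB'.
have [AA'|[a aA]] := set_0Vmem (A :\: A').
  have sub : A \subset A' by rewrite -finset.setD_eq0 AA'.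
  have [AA'2|[b bA]] := set_0Vmem (A' :\: A).
    by congr #|pred_of_set _|; apply/eqP; rewrite finset.eqEsubset sub -finset.setD_eq0 AA'2 /=.
  by have [b' + _] := ex _ _ AB' AB b bA; rewrite AA' inE.
have [b bA' inB] := ex _ _ AB AB' a aA.
move: (aA) (bA'); rewrite !inE => /andP [aA' aA0] /andP [bA bA'0].
rewrite -(exchange_card aA0 bA); apply: IH => //.
rewrite -ltnS; apply: leq_trans lt; rewrite ltnS; apply: proper_card.
apply/properP; split; last first.
  exists a => //; rewrite !inE eqxx /= (negbTE aA') /=.
  by apply/eqP => ab; rewrite -ab aA0 in bA.
apply/fintype.subsetP => x; rewrite !inE => /andP [xA' /orP [/andP [_ ->]|/eqP xb]].
  by rewrite xA'.
by rewrite xb bA'0 in xA'.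
Qed.

(** This yields both the connectedness of links and the transitivity of parallelism. A basis
    containing [X] and [f] that meets [S] in as many elements as possible works: were [e] and [g]
    both missing, some element outside [S] other than [f] could be exchanged for one of [S]. *)
Lemma bases_augment A S X (f e g : 'I_N) : A \in B -> S \in B ->
  X \subset A -> X \subset S -> f \in A -> e \in S -> g \in S -> e != g ->
  e \notin X -> g \notin X ->
  exists2 S', S' \in B & [&& X \subset S', f \in S' & (e \in S') || (g \in S')].
Proof.
move=> AB SB XA XS fA eS gS eg eX gX; have [_ ex] := HB.
have [fS|fS] := boolP (f \in S).
  by exists S => //; rewrite XS fS eS.
pose P A := [&& A \in B, X \subset A & f \in A].
have PA : P A by rewrite /P AB XA.
case: (@arg_maxnP _ A P (fun A => #|A :&: S|) PA) => A' /and3P [A'B XA' fA'] Amax.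
exists A' => //; rewrite XA' fA' /=; apply/negPn/negP; rewrite negb_or => /andP [eA' gA'].
have cAS := bases_card A'B SB.
have [a] : exists a, a \in (A' :\: S) :\ f.
  apply/set0Pn; rewrite -card_gt0.
  have h1 : (2 <= #|S :\: A'|)%N.
    apply: leq_trans (_ : #|[set e; g]| <= _)%N; first by rewrite cards2 eg.
    by apply: subset_leq_card; apply/fintype.subsetP => x;
      rewrite !inE => /orP [] /eqP ->; rewrite ?eA' ?gA' ?eS ?gS.
  have h2 : #|A' :\: S| = #|S :\: A'|.
    by rewrite !cardsD finset.setIC cAS.
  move: h1; rewrite -h2 (cardsD1 f (A' :\: S)) => h1.
  by rewrite -(ltn_add2l (f \in A' :\: S)) addn0; apply: leq_trans h1; case: (_ \in _).
rewrite !inE => /and3P [af aS aA'].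
have aD : a \in A' :\: S by rewrite inE aS.
have [b] := ex _ _ A'B SB a aD; rewrite inE => /andP [bA' bS] bB.
have PP : P ((A' :\ a) :|: [set b]).
  rewrite /P bB /=; apply/andP; split; last first.
    by rewrite !inE eq_sym af fA'.
  apply/fintype.subsetP => x xX; rewrite !inE (fintype.subsetP XA') // andbT.
  by apply/orP; left; apply/eqP => xa; move: aS; rewrite -xa (fintype.subsetP XS).
apply/negP: (Amax _ PP); rewrite /= -ltnNge.
apply: proper_card; apply/properP; split.
  apply/fintype.subsetP => x; rewrite !inE => /andP [xA' xS]; rewrite xA' xS !andbT.
  by apply/orP; left; apply/eqP => xa; move: aS; rewrite -xa xS.
by exists b; rewrite !inE ?eqxx ?bS ?orbT ?(negbTE bA').
Qed.

End Matroid.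

(** * Lorentzian inequality for external fields *)

Section Multipartite.
Variables (R : realType) (I K : finType) (cl : I -> K).

Definition multi_form (x y : I -> R) : R :=
  \sum_e \sum_f (cl e != cl f)%:R * x e * y f.

Lemma multi_formE x y : multi_form x y = (\sum_e x e) * (\sum_f y f)
  - \sum_c (\sum_(e | cl e == c) x e) * (\sum_(f | cl f == c) y f).
Proof.
have -> : \sum_c (\sum_(e | cl e == c) x e) * (\sum_(f | cl f == c) y f) =
    \sum_e \sum_f (cl e == cl f)%:R * x e * y f.
  under eq_bigr do rewrite mulr_suml.
  rewrite (exchange_big_dep predT) //=; apply: eq_bigr => e _.
  rewrite (big_pred1 (cl e)) //= big_mkcond mulr_sumr; apply: eq_bigr => f _.
  by rewrite eq_sym; case: eqP => _; rewrite ?mul1r // ?mul0r ?mulr0.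
rewrite mulr_suml -sumrB; apply: eq_bigr => e _.
rewrite mulr_sumr -sumrB; apply: eq_bigr => f _.
by case: eqP => _ /=; ring.
Qed.

(** Aczel's inequality, the reverse Cauchy-Schwarz inequality for a form with one positive square;
    [s], [t] and [w] stand for the Gram matrix of the negative part. *)
Lemma lorentz_num (X Y w s t : R) : 0 <= s -> 0 <= t -> w ^+ 2 <= s * t ->
  0 <= X * X - s -> 0 < Y * Y - t ->
  (X * X - s) * (Y * Y - t) <= (X * Y - w) ^+ 2.
Proof.
move=> s0 t0 wst Xs Yt.
have [p p0 sE] : exists2 p, 0 <= p & s = p ^+ 2.
  by exists (Num.sqrt s); rewrite ?sqrtr_ge0 ?sqr_sqrtr.
have [q q0 tE] : exists2 q, 0 <= q & t = q ^+ 2.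
  by exists (Num.sqrt t); rewrite ?sqrtr_ge0 ?sqr_sqrtr.
subst s t.
have wpq : `|w| <= p * q.
  rewrite -(@ler_pXn2r _ 2) ?nnegrE ?mulr_ge0 //.
  by rewrite real_normK ?num_real // exprMn.
have pX : p <= `|X|.
  by rewrite -(@ler_pXn2r _ 2) ?nnegrE // real_normK ?num_real // expr2 [leRHS]expr2; lra.
have qY : q <= `|Y|.
  by rewrite -(@ler_pXn2r _ 2) ?nnegrE // real_normK ?num_real // expr2 [leRHS]expr2; lra.
have pqXY : p * q <= `|X| * `|Y| by exact: ler_pM.
have h1 : `|X| * `|Y| - p * q <= `|X * Y - w|.
  by apply: le_trans (lerB_dist _ _); rewrite normrM; lra.
have h2 : (`|X| * `|Y| - p * q) ^+ 2 <= (X * Y - w) ^+ 2.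
  rewrite -[leRHS]real_normK ?num_real // ler_pXn2r ?nnegrE //; lra.
apply: le_trans h2.
have -> : X * X = `|X| ^+ 2 by rewrite real_normK ?num_real.
have -> : Y * Y = `|Y| ^+ 2 by rewrite real_normK ?num_real.
rewrite -subr_ge0.
have -> : (`|X| * `|Y| - p * q) ^+ 2 - (`|X| ^+ 2 - p ^+ 2) * (`|Y| ^+ 2 - q ^+ 2) =
  (`|X| * q - `|Y| * p) ^+ 2 by ring.
exact: sqr_ge0.
Qed.

Lemma multi_form_reverse_CS x y : (forall e, 0 <= x e) ->
  multi_form x x * multi_form y y <= multi_form x y ^+ 2.
Proof.
move=> x0; have E0 : 0 <= multi_form x x.
  by apply: sumr_ge0 => e _; apply: sumr_ge0 => f _; rewrite !mulr_ge0.
have [Ey|Ey] := leP (multi_form y y) 0.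
  by apply: le_trans (sqr_ge0 _); rewrite mulr_ge0_le0.
have CS := @sum_CauchySchwarz R K (fun=> 1) (fun c => \sum_(e | cl e == c) x e)
  (fun c => \sum_(e | cl e == c) y e) (fun=> ler01).
move: E0 Ey; rewrite !multi_formE => E0 Ey; apply: lorentz_num E0 Ey.
- by apply: sumr_ge0 => c _; rewrite -expr2 sqr_ge0.
- by apply: sumr_ge0 => c _; rewrite -expr2 sqr_ge0.
- apply: le_trans (le_trans CS _); rewrite le_eqVlt; apply/orP; left; apply/eqP.
    by congr (_ ^+ 2); apply: eq_bigr => c _; rewrite mul1r.
  by congr (_ * _); apply: eq_bigr => c _; rewrite mul1r expr2.
Qed.
End Multipartite.

(** * Degrees and pair degrees in the links *)

Section Lorentzian.
Variables (R : realType) (N : nat) (B : {set {set 'I_N}}) (r : nat).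
Hypothesis HB : is_matroid_bases B.
Hypothesis rank : forall S, S \in B -> #|S| = r.
Variable h : 'I_N -> R.
Implicit Types (sg S : {set 'I_N}) (e f : 'I_N) (u : 'I_N -> R).

Definition basis_wgt S : R := (S \in B)%:R * expR (lin h S).
Definition above_wgt sg S : R := (sg \subset S)%:R * basis_wgt S.
Definition off sg S e : R := ((e \notin sg) && (e \in S))%:R.
(** The sum of [u e * u f] over ordered pairs of distinct elements of [S]: the second derivative at
    1, in direction [u], of the monomial of [S]. *)
Definition quad u S : R := lin u S ^+ 2 - lin (fun e => u e ^+ 2) S.

Definition degree sg e : R := \sum_S above_wgt sg S * off sg S e.
Definition pair_degree sg e f : R :=
  (e != f)%:R * \sum_S above_wgt sg S * off sg S e * off sg S f.

Lemma above_ge0 sg S : 0 <= above_wgt sg S.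
Proof. by rewrite !mulr_ge0 ?expR_ge0. Qed.

Lemma off_ge0 sg S e : 0 <= off sg S e. Proof. exact: ler0n. Qed.

Lemma off_idem sg S e : off sg S e * off sg S e = off sg S e.
Proof. by rewrite /off; case: (_ && _); rewrite ?mulr1 ?mulr0. Qed.

Lemma above_ind sg S (x y : R) : (S \in B -> sg \subset S -> x = y) ->
  above_wgt sg S * x = above_wgt sg S * y.
Proof.
rewrite /above_wgt /basis_wgt => H.
case sS : (sg \subset S); last by rewrite !mul0r.
by case SB : (S \in B); [rewrite H|rewrite !mul0r !mulr0 !mul0r].
Qed.

Lemma sum_off sg S k : S \in B -> sg \subset S -> (#|sg| + k)%N = r ->
  \sum_e off sg S e = k%:R.
Proof.
move=> SB sS kr.
have -> : \sum_e off sg S e = \sum_(e in S :\: sg) 1.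
  rewrite [RHS]big_mkcond; apply: eq_bigr => e _; rewrite /off finset.in_setD.
  by case: (_ && _).
by rewrite sumr_const cardsDS // rank // -kr addKn.
Qed.

Lemma lin_off sg u S : (forall e, e \in sg -> u e = 0) ->
  lin u S = \sum_e u e * off sg S e.
Proof.
move=> u0; apply: eq_bigr => e _; rewrite /off.
by case: (boolP (e \in sg)) => //= /u0 ->; rewrite !mul0r.
Qed.

Lemma sum_neq (g : 'I_N -> R) e : \sum_f (e != f)%:R * g f = \sum_f g f - g e.
Proof.
rewrite [in RHS](bigD1 e) //= addrC addrK [LHS](bigD1 e) //= eqxx mul0r add0r.
by apply: eq_bigr => f fe; rewrite eq_sym fe mul1r.
Qed.

Lemma codegC sg e f : pair_degree sg e f = pair_degree sg f e.
Proof.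
by rewrite /pair_degree eq_sym; congr (_ * _); apply: eq_bigr => S _; rewrite mulrAC.
Qed.

Lemma codeg_ge0 sg e f : 0 <= pair_degree sg e f.
Proof.
by rewrite mulr_ge0 //; apply: sumr_ge0 => S _; rewrite !mulr_ge0 ?above_ge0 ?off_ge0.
Qed.

Lemma deg_ge0 sg e : 0 <= degree sg e.
Proof. by apply: sumr_ge0 => S _; rewrite mulr_ge0 ?above_ge0 ?off_ge0. Qed.

Lemma codegE sg (g : 'I_N -> R) e : \sum_f pair_degree sg e f * g f =
  \sum_S above_wgt sg S * (off sg S e * (\sum_f off sg S f * g f - g e)).
Proof.
transitivity (\sum_f \sum_S above_wgt sg S * (off sg S e * ((e != f)%:R * (off sg S f * g f)))).
  apply: eq_bigr => f _; rewrite /pair_degree -mulrA mulr_suml mulr_sumr.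
  by apply: eq_bigr => S _; ring.
rewrite exchange_big; apply: eq_bigr => S _ /=.
rewrite -mulr_sumr -mulr_sumr sum_neq; congr (_ * _).
by rewrite !mulrBr !mulrA off_idem.
Qed.

Lemma codeg_row sg k e : (#|sg| + k.+1)%N = r ->
  \sum_f pair_degree sg e f = k%:R * degree sg e.
Proof.
move=> kr; transitivity (\sum_f pair_degree sg e f * 1).
  by apply: eq_bigr => f _; rewrite mulr1.
rewrite codegE /degree mulr_sumr; apply: eq_bigr => S _; rewrite [RHS]mulrCA.
apply: above_ind => SB sS.
have -> : \sum_f off sg S f * 1 = k.+1%:R.
  by rewrite -(sum_off SB sS kr); apply: eq_bigr => f _; rewrite mulr1.
by rewrite -natr1 addrK mulrC.
Qed.

Lemma sum_deg sg k : (#|sg| + k)%N = r ->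
  \sum_e degree sg e = k%:R * \sum_S above_wgt sg S.
Proof.
move=> kr; rewrite exchange_big mulr_sumr; apply: eq_bigr => S _ /=.
rewrite -mulr_sumr [RHS]mulrC; apply: above_ind => SB sS; exact: sum_off.
Qed.

Section Vanishing.
Variables (sg : {set 'I_N}) (u : 'I_N -> R).
Hypothesis u_sg : forall e, e \in sg -> u e = 0.

Lemma sum_deg_mul : \sum_e degree sg e * u e = \sum_S above_wgt sg S * lin u S.
Proof.
under eq_bigr do rewrite mulr_suml.
rewrite exchange_big; apply: eq_bigr => S _ /=.
by rewrite (lin_off _ u_sg) mulr_sumr; apply: eq_bigr => e _; ring.
Qed.

Lemma codeg_mul e : \sum_f pair_degree sg e f * u f =
  \sum_S above_wgt sg S * (off sg S e * (lin u S - u e)).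
Proof.
rewrite codegE; apply: eq_bigr => S _; rewrite (lin_off _ u_sg).
by under eq_bigr do rewrite mulrC.
Qed.

Lemma quad_off S : quad u S = \sum_e u e * off sg S e * (lin u S - u e).
Proof.
rewrite /quad (@lin_off sg (fun e => u e ^+ 2)); last first.
  by move=> e /u_sg ->; rewrite expr0n.
rewrite expr2 {1}(lin_off _ u_sg) mulr_suml -sumrB; apply: eq_bigr => e _.
by ring.
Qed.

Lemma codeg_form : \sum_e \sum_f pair_degree sg e f * u e * u f =
  \sum_S above_wgt sg S * quad u S.
Proof.
transitivity (\sum_e u e * \sum_S above_wgt sg S * (off sg S e * (lin u S - u e))).
  apply: eq_bigr => e _; rewrite -codeg_mul mulr_sumr; apply: eq_bigr => f _.
  by rewrite mulrA [u e * _]mulrC.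
under eq_bigr do rewrite mulr_sumr.
rewrite exchange_big; apply: eq_bigr => S _ /=.
by rewrite quad_off mulr_sumr; apply: eq_bigr => e _; ring.
Qed.

End Vanishing.

Lemma above_setU1 sg e S : e \notin sg ->
  above_wgt (e |: sg) S = above_wgt sg S * off sg S e.
Proof.
move=> esg; rewrite /above_wgt /off esg /= finset.subUset finset.sub1set.
by case: (e \in S); rewrite /= ?mulr1 // ?mul0r ?mulr0.
Qed.

(** Double counting: a pair in [S :\: sg] survives the deletion of [e] for exactly the [k] elements
    [e] outside it. *)
Lemma quad_link sg u S k : (forall e, e \in sg -> u e = 0) ->
  S \in B -> sg \subset S -> (#|sg| + k.+2)%N = r ->
  \sum_e off sg S e * quad (fun f => (f != e)%:R * u f) S = k%:R * quad u S.
Proof.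
move=> u0 SB sS kr.
transitivity (\sum_e (off sg S e * quad u S - 2 * (u e * off sg S e * (lin u S - u e)))).
  apply: eq_bigr => e _; rewrite /off.
  case: (boolP ((e \notin sg) && (e \in S))) => [/andP [esg eS]|_]; last by rewrite /=; ring.
  have lin_e (v : 'I_N -> R) : lin (fun f => (f != e)%:R * v f) S = lin v S - v e.
    rewrite /lin (bigD1 e) //= eqxx mul0r mul0r add0r [in RHS](bigD1 e) //= eS mulr1.
    by rewrite addrC addrK; apply: eq_bigr => f ->; rewrite mul1r.
  rewrite /quad lin_e (_ : (fun f => _) = (fun f => (f != e)%:R * u f ^+ 2)).
    by rewrite lin_e /=; ring.
  by apply/funext => f; case: (f != e) => /=; ring.
rewrite sumrB -mulr_suml -[X in _ - X]mulr_sumr -(quad_off u0) (sum_off SB sS kr).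
by rewrite -natr1 -natr1; ring.
Qed.

Lemma deg_gt0 sg e : 0 < degree sg e ->
  [/\ e \notin sg & exists S, [/\ S \in B, sg \subset S & e \in S]].
Proof.
move=> d0; have [S] : exists S, above_wgt sg S * off sg S e != 0.
  apply/existsP; rewrite -negb_forall; apply/negP => /forallP H.
  by move: d0; rewrite /degree big1 ?ltxx // => S _; apply/eqP; exact: H.
rewrite /above_wgt /basis_wgt /off.
case: (boolP (e \in sg)) => [_|esg]; first by rewrite mulr0 eqxx.
case: (boolP (e \in S)) => [eS|_]; last by rewrite mulr0 eqxx.
case: (boolP (sg \subset S)) => [sS|_]; last by rewrite !mul0r eqxx.
case: (boolP (S \in B)) => [SB|_]; last by rewrite mul0r mulr0 mul0r eqxx.
by move=> _; split=> //; exists S.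
Qed.

Lemma codeg_gt0 sg e f S : S \in B -> sg \subset S -> e \in S -> f \in S ->
  e != f -> e \notin sg -> f \notin sg -> 0 < pair_degree sg e f.
Proof.
move=> SB sS eS fS ef esg fsg; rewrite /pair_degree ef mul1r (bigD1 S) //= ltr_wpDr //.
  by apply: sumr_ge0 => S' _; rewrite !mulr_ge0 ?above_ge0 ?off_ge0.
by rewrite /above_wgt /basis_wgt /off sS SB eS fS esg fsg !mul1r !mulr1 expR_gt0.
Qed.

(** Connectedness with paths of length at most 2: if [g] accompanies [e] in a basis above [sg],
    augmentation joins [f] to [e] or to [g]. *)
Lemma codeg_connected sg k u : (#|sg| + k.+2)%N = r ->
  (forall e f, 0 < pair_degree sg e f -> u e = u f) ->
  forall e f, 0 < degree sg e -> 0 < degree sg f -> u e = u f.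
Proof.
move=> kr H e f /deg_gt0 [esg [S [SB sS eS]]] /deg_gt0 [fsg [S' [S'B sS' fS']]].
have [->//|ef] := eqVneq e f.
have [g] : exists g, g \in (S :\: sg) :\ e.
  apply/set0Pn; rewrite -card_gt0.
  have := cardsD1 e (S :\: sg); rewrite (cardsDS sS) (rank SB) -kr addKn inE esg eS /=.
  by rewrite add1n => -[<-].
rewrite !inE => /and3P [ge gsg gS].
have [gf|gf] := eqVneq g f.
  by apply: H; rewrite -gf; apply: (codeg_gt0 SB); rewrite // eq_sym.
have eg : e != g by rewrite eq_sym.
have [S'' S''B /and3P [sS'' fS'' /orP [eS''|gS'']]] :=
  bases_augment HB S'B SB sS' sS fS' eS gS eg esg gsg.
  by apply: H; apply: (codeg_gt0 S''B).
rewrite (H e g); first by apply: H; apply: (codeg_gt0 S''B).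
exact: (codeg_gt0 SB).
Qed.

End Lorentzian.

Section LorentzianInduction.
Variables (R : realType) (N : nat) (B : {set {set 'I_N}}) (r : nat).
Hypothesis HB : is_matroid_bases B.
Hypothesis rank : forall S, S \in B -> #|S| = r.
Variable h : 'I_N -> R.
Implicit Types (sg S : {set 'I_N}) (e f : 'I_N) (u : 'I_N -> R).

Local Notation above := (above_wgt B h).
Local Notation codeg := (pair_degree B h).
Local Notation deg := (degree B h).

(** * Links of rank two *)

Section RankTwo.
Variable sg : {set 'I_N}.
Hypothesis sg_rank : (#|sg| + 2)%N = r.

Definition independent e f : bool :=
  [&& e != f, e \notin sg, f \notin sg & e |: (f |: sg) \in B].
Definition nonloop e : bool :=
  (e \notin sg) && [exists S, [&& S \in B, sg \subset S & e \in S]].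
(** A canonical representative: parallel nonloops select by equivalent predicates, so [pick] returns
    the same element. The value at loops is irrelevant, their weight [zwgt] being 0. *)
Definition parallel_class e : 'I_N :=
  odflt e [pick f | nonloop f && ~~ independent e f].

Lemma independentC e f : independent e f = independent f e.
Proof.
rewrite /independent eq_sym; case: (e \in sg); case: (f \in sg); rewrite //= ?andbF //.
by rewrite finset.setUCA.
Qed.

Lemma card_pair e f : e != f -> e \notin sg -> f \notin sg ->
  #|e |: (f |: sg)| = r.
Proof.
move=> ef esg fsg; rewrite !cardsU1 !inE (negbTE ef) (negbTE esg) (negbTE fsg) /=.
by rewrite -sg_rank addnC -addnA addn1 addn2 add1n.
Qed.

Lemma pair_basis e f S : S \in B -> sg \subset S -> e \in S -> f \in S ->
  e != f -> e \notin sg -> f \notin sg -> S = e |: (f |: sg).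
Proof.
move=> SB sS eS fS ef esg fsg; apply/esym/eqP.
rewrite eqEcard card_pair // rank // leqnn andbT.
by rewrite !finset.subUset !finset.sub1set eS fS.
Qed.

Lemma independent_nonloop e f : independent e f -> nonloop e.
Proof.
move=> /and4P [ef esg fsg efB]; rewrite /nonloop esg; apply/existsP.
exists (e |: (f |: sg)); rewrite efB !inE eqxx /= andbT.
by apply/fintype.subsetP => x xs; rewrite !inE xs !orbT.
Qed.

(** The contrapositive is transitivity of parallelism through a nonloop. *)
Lemma independent_trans e f g : nonloop f -> independent e g ->
  independent e f || independent f g.
Proof.
move=> /andP [fsg /existsP [S' /and3P [S'B sS' fS']]] eg0.
have [->|fe] := eqVneq f e; first by rewrite eg0 orbT.
have [->|fg] := eqVneq f g; first by rewrite eg0.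
move: eg0 => /and4P [eg esg gsg egB].
have sub : sg \subset e |: (g |: sg).
  by apply/fintype.subsetP => x xs; rewrite !inE xs !orbT.
have eS : e \in e |: (g |: sg) by rewrite !inE eqxx.
have gS : g \in e |: (g |: sg) by rewrite !inE eqxx orbT.
have [S'' S''B /and3P [sS'' fS'' /orP [eS''|gS'']]] :=
  bases_augment HB S'B egB sS' sub fS' eS gS eg esg gsg.
  have ef : e != f by rewrite eq_sym.
  by rewrite /independent ef esg fsg /= -(pair_basis S''B) // S''B.
apply/orP; right; rewrite /independent fg fsg gsg /=.
by rewrite -(pair_basis S''B sS'' fS'' gS'' fg fsg gsg).
Qed.

Lemma parallel_classP e f : nonloop e -> nonloop f ->
  (parallel_class e != parallel_class f) = independent e f.
Proof.
move=> Ve Vf.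
have irr g : independent g g = false by rewrite /independent eqxx.
have [g cle /andP [Vg eg]] : exists2 g, parallel_class e = g & nonloop g && ~~ independent e g.
  rewrite /parallel_class; case: pickP => [g Hg|/(_ e)]; first by exists g.
  by rewrite Ve irr.
have [k clf /andP [Vk fk]] : exists2 g, parallel_class f = g & nonloop g && ~~ independent f g.
  rewrite /parallel_class; case: pickP => [k Hk|/(_ f)]; first by exists k.
  by rewrite Vf irr.
case ef : (independent e f).
  apply/eqP => gk; have := independent_trans Vg ef.
  by rewrite (negbTE eg) /= -cle gk clf independentC (negbTE fk).
apply/negbTE; rewrite negbK; apply/eqP.
rewrite /parallel_class (@eq_pick _ _ [pred g | nonloop g && ~~ independent f g]); last first.
  move=> x /=; case Vx : (nonloop x) => //=; congr (~~ _); apply/idP/idP => H.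
    by have := independent_trans Vf H; rewrite ef.
  by have := independent_trans Ve H; rewrite independentC ef.
by case: pickP => //= /(_ f); rewrite /= Vf irr.
Qed.

Definition zwgt e : R := (nonloop e)%:R * expR (h e).

(** In rank two a pair determines the basis, so its weight factorises: the link is a complete
    multipartite graph on the parallel classes, with vertex weights. *)
Lemma codeg_multi e f : codeg sg e f = expR (lin h sg) *
  ((parallel_class e != parallel_class f)%:R * zwgt e * zwgt f).
Proof.
have -> : (parallel_class e != parallel_class f)%:R * zwgt e * zwgt f =
    (independent e f)%:R * (expR (h e) * expR (h f)).
  rewrite /zwgt; case Ve : (nonloop e); last first.
    have -> : independent e f = false.
      by apply/negP => /independent_nonloop; rewrite Ve.
    by rewrite !(mul0r, mulr0).
  case Vf : (nonloop f); last first.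
    have -> : independent e f = false.
      by apply/negP; rewrite independentC => /independent_nonloop; rewrite Vf.
    by rewrite !(mul0r, mulr0).
  by rewrite parallel_classP // !mul1r mulrA.
rewrite /pair_degree /independent.
have [->|ef] := eqVneq e f; first by rewrite !mul0r mulr0.
have [esg|esg] := boolP (e \in sg).
  rewrite /= mul0r mulr0 mul1r big1 // => S _.
  by rewrite /off esg mulr0 mul0r.
have [fsg|fsg] := boolP (f \in sg).
  by rewrite /= mul0r mulr0 mul1r big1 // => S _; rewrite /off fsg mulr0.
rewrite mul1r (bigD1 (e |: (f |: sg))) //= big1 ?addr0; last first.
  move=> S neS; rewrite /above_wgt /basis_wgt /off esg fsg /=.
  case: (boolP (e \in S)) => eS; last by rewrite mulr0 mul0r.
  case: (boolP (f \in S)) => fS; last by rewrite mulr0.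
  case: (boolP (sg \subset S)) => sS; last by rewrite !mul0r.
  case: (boolP (S \in B)) => SB; last by rewrite mul0r mulr0 !mul0r.
  by move: neS; rewrite -(pair_basis SB sS eS fS ef esg fsg) eqxx.
rewrite /above_wgt /basis_wgt /off esg fsg !inE !eqxx orbT /= !mulr1.
have -> : sg \subset e |: (f |: sg).
  by apply/fintype.subsetP => x xs; rewrite !inE xs !orbT.
rewrite mul1r mulrCA; congr (_ * _).
rewrite -!expRD; congr (expR _).
have linU v (X : {set 'I_N}) (k : 'I_N -> R) : v \notin X -> lin k (v |: X) = k v + lin k X.
  move=> vX; rewrite /lin (bigD1 v) //= [in RHS](bigD1 v) //= !inE eqxx (negbTE vX).
  rewrite mulr0 add0r mulr1; congr (_ + _); apply: eq_bigr => x xv.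
  by rewrite !inE (negbTE xv).
by rewrite !linU ?inE ?(negbTE ef) //; ring.
Qed.

Lemma lorentzian_rank2 u : (forall e, e \in sg -> u e = 0) ->
  2 * (\sum_S above sg S) * (\sum_S above sg S * quad u S)
  <= (\sum_S above sg S * lin u S) ^+ 2.
Proof.
move=> u0; have row e := codeg_row rank h e (sg_rank : (#|sg| + 1.+1)%N = r).
have -> : 2 * (\sum_S above sg S) = \sum_e \sum_f codeg sg e f.
  rewrite -(sum_deg rank h sg_rank); apply: eq_bigr => e _.
  by rewrite row mul1r.
rewrite -(codeg_form B h u0) -(sum_deg_mul B h u0).
have -> : \sum_e deg sg e * u e = \sum_e \sum_f codeg sg f e * u e.
  apply: eq_bigr => e _; rewrite -mulr_suml.
  by under eq_bigr do rewrite codegC; rewrite row mul1r.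
pose C := expR (lin h sg); pose x e := zwgt e; pose y e := zwgt e * u e.
have x0 e : 0 <= x e by rewrite mulr_ge0 ?expR_ge0.
have E0 : \sum_e \sum_f codeg sg e f = C * multi_form parallel_class x x.
  rewrite mulr_sumr; apply: eq_bigr => e _; rewrite mulr_sumr.
  by apply: eq_bigr => f _; rewrite codeg_multi.
have E1 : \sum_e \sum_f codeg sg e f * u e * u f = C * multi_form parallel_class y y.
  rewrite mulr_sumr; apply: eq_bigr => e _; rewrite mulr_sumr.
  by apply: eq_bigr => f _; rewrite codeg_multi /y /C; ring.
have E2 : \sum_e \sum_f codeg sg f e * u e = C * multi_form parallel_class x y.
  rewrite exchange_big mulr_sumr; apply: eq_bigr => e _ /=; rewrite mulr_sumr.
  by apply: eq_bigr => f _; rewrite codeg_multi /y /x /C; ring.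
rewrite E0 E1 E2 exprMn mulrACA -expr2 ler_wpM2l ?sqr_ge0 //.
exact: multi_form_reverse_CS.
Qed.

End RankTwo.

(** The factor [(d - 1) / d], with [d = n.+2] the rank of the link, is sharp (equality at [u = 1]
    off [sg]) and is what trickle-down reproduces one rank higher. *)
Lemma lorentzian n sg u : (#|sg| + n.+2)%N = r ->
  (forall e, e \in sg -> u e = 0) ->
  n.+2%:R * (\sum_S above sg S) * (\sum_S above sg S * quad u S)
  <= n.+1%:R * (\sum_S above sg S * lin u S) ^+ 2.
Proof.
elim: n sg u => [|n IH] sg u kr u0.
  by rewrite mul1r; exact: (lorentzian_rank2 kr u0).
rewrite -(sum_deg rank h kr) -(codeg_form B h u0) -(sum_deg_mul B h u0).
apply: trickle_down.
- by move=> e f; exact: codegC.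
- by move=> e f; exact: codeg_ge0.
- by move=> e; exact: deg_ge0.
- by rewrite ltr0n.
- by move=> e; exact: (codeg_row rank h e kr).
- by move=> v; apply: (codeg_connected HB rank kr).
move=> v v0.
have v_sg e : e \in sg -> v e = 0.
  move=> esg; apply: v0; rewrite /degree big1 // => S _.
  by rewrite /off esg mulr0.
pose Q e := \sum_S above sg S * (off R sg S e * quad (fun f => (f != e)%:R * v f) S).
have sumQ : \sum_e Q e = n.+1%:R * \sum_S above sg S * quad v S.
  rewrite exchange_big mulr_sumr; apply: eq_bigr => S _ /=.
  rewrite -mulr_sumr [RHS]mulrCA; apply: above_ind => SB sS.
  exact: (quad_link rank v_sg SB sS kr).
(* The induction hypothesis in the link of [e], for [v] with its coordinate at [e] erased. Summed
   over [e], the factor [n.+1] cancels that of [sumQ] and leaves the local hypothesis of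
   [trickle_down]. *)
have leQ e : n.+2%:R * Q e <= n.+1%:R * ((\sum_f codeg sg e f * v f) ^+ 2 / deg sg e).
  have [d0|dn0] := eqVneq (deg sg e) 0.
    have z S : above sg S * off R sg S e = 0.
      move/eqP: d0; rewrite /degree psumr_eq0; last first.
        by move=> S' _; rewrite mulr_ge0 ?above_ge0 ?off_ge0.
      by move=> /allP/(_ S (mem_index_enum S))/eqP.
    by rewrite d0 invr0 mulr0 mulr0 /Q big1 ?mulr0 // => S _; rewrite mulrA z mul0r.
  have dp : 0 < deg sg e by rewrite lt_neqAle eq_sym dn0 deg_ge0.
  have [esg _] := deg_gt0 dp.
  have cU : (#|e |: sg| + n.+2)%N = r by rewrite cardsU1 esg -kr add1n addSnnS.
  pose w f := (f != e)%:R * v f.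
  have w0 f : f \in e |: sg -> w f = 0.
    rewrite !inE /w; case: eqVneq => [_ _|_ /= /v_sg ->]; first by rewrite mul0r.
    by rewrite mulr0.
  have := IH _ _ cU w0.
  have -> : \sum_S above (e |: sg) S = deg sg e.
    by apply: eq_bigr => S _; rewrite above_setU1.
  have -> : \sum_S above (e |: sg) S * quad w S = Q e.
    by apply: eq_bigr => S _; rewrite above_setU1 // -mulrA.
  have -> : \sum_S above (e |: sg) S * lin w S = \sum_f codeg sg e f * v f.
    rewrite (codeg_mul B h v_sg); apply: eq_bigr => S _.
    rewrite above_setU1 // -mulrA; congr (_ * _); rewrite /off esg /=.
    case: (boolP (e \in S)) => [eS|_]; last by rewrite !mul0r.
    rewrite !mul1r /lin (bigD1 e) //= [in RHS](bigD1 e) //= /w eqxx !mul0r add0r eS mulr1.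
    by rewrite addrC addrK; apply: eq_bigr => f ->; rewrite mul1r.
  by move=> H; rewrite mulrA ler_pdivlMr // mulrAC; lra.
have n1 : 0 < n.+1%:R :> R by rewrite ltr0n.
rewrite -(ler_pM2l n1) (codeg_form B h v_sg) mulrCA -sumQ mulr_sumr mulr_sumr.
by apply: ler_sum => e _.
Qed.

(* The weak form, valid in every rank: log-concavity of the generating
   polynomial at the weights [expR h]. *)
Lemma quad_le sg u : (forall e, e \in sg -> u e = 0) ->
  (\sum_S above sg S) * (\sum_S above sg S * quad u S)
  <= (\sum_S above sg S * lin u S) ^+ 2.
Proof.
move=> u0; have Z0 : 0 <= \sum_S above sg S by apply: sumr_ge0 => S _; exact: above_ge0.
have [kr|kr] := leqP #|sg|.+2 r.
  have [n kn] : exists n, (#|sg| + n.+2)%N = r.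
    by exists (r - #|sg|.+2)%N; rewrite -addSnnS -addSnnS subnKC.
  have := lorentzian kn u0; set Z := \sum_S _; set X := \sum_S _; set Y := (_ ^+ 2).
  have n0 : 0 < n.+2%:R :> R by rewrite ltr0n.
  move=> H; rewrite -(ler_pM2l n0) mulrA; apply: le_trans H _.
  by apply: ler_wpM2r; rewrite ?sqr_ge0 // ler_nat.
suff -> : \sum_S above sg S * quad u S = 0 by rewrite mulr0 sqr_ge0.
apply: big1 => S _; rewrite -[RHS](mulr0 (above sg S)); apply: above_ind => SB sS.
rewrite (quad_off u0); apply: big1 => e _; rewrite /off.
case: (boolP ((e \notin sg) && (e \in S))) => [/andP [esg eS]|_]; last by rewrite mulr0 mul0r.
suff -> : lin u S = u e by rewrite subrr mulr0.
rewrite (lin_off _ u0) (bigD1 e) //= /off esg eS mulr1 big1 ?addr0 // => f fe.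
case: (boolP ((f \notin sg) && (f \in S))) => [/andP [fsg fS]|_]; last by rewrite mulr0.
have : (#|e |: (f |: sg)| <= #|S|)%N.
  by apply: subset_leq_card; rewrite !finset.subUset !finset.sub1set eS fS.
rewrite (rank SB) !cardsU1 !inE (negbTE esg) fsg eq_sym (negbTE fe) /= !add1n => H.
by move: (leq_trans kr H); rewrite ltnn.
Qed.

End LorentzianInduction.

(** * Entropy factorisation for external fields *)

Section BaseCase.
Variables (R : realType) (N : nat) (B : {set {set 'I_N}}) (r : nat).
Hypothesis HB : is_matroid_bases B.
Hypothesis rank : forall S, S \in B -> #|S| = r.
Implicit Types (sg S : {set 'I_N}) (e f : 'I_N) (h u : 'I_N -> R).

Lemma wgt0E (th : 'I_N -> 'I_N -> R) h : wgt B th 0 h = basis_wgt B h.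
Proof. by apply/funext => S; rewrite /wgt mul0r addr0. Qed.

Lemma above0E h : above_wgt B h finset.set0 = basis_wgt B h.
Proof. by apply/funext => S; rewrite /above_wgt finset.sub0set mul1r. Qed.

(** By log-concavity the off-diagonal second moments in direction [u] are at most the squared mean,
    so the covariance is at most the diagonal matrix of means, with entries at most 1. *)
Lemma cov_bound0 (th : 'I_N -> 'I_N -> R) : cov_bound B th 1 0.
Proof.
move=> h u; rewrite wgt0E.
have Z0 : 0 < \sum_S basis_wgt B h S.
  by have := wgt_mass_gt0 th 0 h (proj1 HB); rewrite wgt0E.
have u0 e : e \in (finset.set0 : {set 'I_N}) -> u e = 0 by rewrite finset.in_set0.
have H := quad_le HB rank h u0; rewrite above0E in H.
rewrite /fvar mul1r.
rewrite mulrC -ler_pdivlMr // in H.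
have h1 : \sum_S basis_wgt B h S * lin u S ^+ 2 = \sum_S basis_wgt B h S * quad u S +
    \sum_S basis_wgt B h S * lin (fun e => u e ^+ 2) S.
  by rewrite -big_split; apply: eq_bigr => S _; rewrite /quad /=; ring.
have h2 : \sum_S basis_wgt B h S * lin (fun e => u e ^+ 2) S <=
    sqnorm u * \sum_S basis_wgt B h S.
  rewrite mulr_sumr; apply: ler_sum => S _; rewrite mulrC ler_wpM2r //.
    by rewrite mulr_ge0 ?expR_ge0.
  apply: ler_sum => e _; rewrite -[leRHS]mulr1 ler_wpM2l ?sqr_ge0 //.
  by case: (e \in S).
lra.
Qed.

Section Fixed.
Variable h : 'I_N -> R.
Local Notation above := (above_wgt B h).
Local Notation deg := (degree B h).
Local Notation base_wgt := (basis_wgt B h).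

(* The tangent inequality at [z = 1] expressing that the logarithm of the
   generating polynomial is concave. *)
Lemma ln_genpoly_le sg (z : 'I_N -> R) : (forall e, 0 < z e) ->
  (forall e, e \in sg -> z e = 1) -> 0 < \sum_S above sg S ->
  ln (\sum_S above sg S * expR (lin (fun e => ln (z e)) S)) <=
  ln (\sum_S above sg S)
    + (\sum_S above sg S * lin (fun e => z e - 1) S) / (\sum_S above sg S).
Proof.
move=> z0 z1 Z0; pose v e := z e - 1.
have pos e (t : R) : 0 <= t <= 1 -> 0 < 1 + t * v e.
  by move=> /andP [t0 t1]; have := z0 e; rewrite /v; nra.
have := @ln_sum_expR_second_order R _ (above sg)
  (fun S t => lin (fun e => ln (1 + t * v e)) S)
  (fun S t => lin (fun e => v e / (1 + t * v e)) S)
  (fun S t => lin (fun e => - (v e / (1 + t * v e)) ^+ 2) S) 0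
  (above_ge0 B h sg) Z0.
have e1 S : above sg S * expR (lin (fun e => ln (1 + 1 * v e)) S) =
    above sg S * expR (lin (fun e => ln (z e)) S).
  congr (_ * expR _); apply: eq_bigr => e _.
  by rewrite mul1r /v addrC subrK.
have e0 S : above sg S * expR (lin (fun e => ln (1 + 0 * v e)) S) = above sg S.
  rewrite (_ : lin _ _ = 0) ?expR0 ?mulr1 //; apply: big1 => e _.
  by rewrite mul0r addr0 ln1 mul0r.
have e0' S : above sg S * expR (lin (fun e => ln (1 + 0 * v e)) S) *
   lin (fun e => v e / (1 + 0 * v e)) S = above sg S * lin (fun e => z e - 1) S.
  rewrite e0; congr (_ * _); apply: eq_bigr => e _.
  by rewrite mul0r addr0 divr1.
rewrite (eq_bigr _ (fun S _ => e1 S)) (eq_bigr _ (fun S _ => e0 S)).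
rewrite (eq_bigr _ (fun S _ => e0' S)) mul0r addr0; apply.
- move=> S t tI; apply: is_derive_finsum => e.
  have p := pos e t tI.
  have h1 : is_derive t 1 ((v e) \*: (@id R)) (v e *: 1) by exact: is_deriveZ.
  have h2 : is_derive t 1 (cst 1 \+ (v e) \*: (@id R)) (0 + v e *: 1).
    by apply: is_deriveD.
  have p' : 0 < (cst 1 \+ (v e) \*: (@id R)) t by rewrite /= /GRing.scale /= mulrC.
  have h3 := is_derive1_comp (is_derive1_ln p') h2.
  have h4 : is_derive t 1 ((e \in S)%:R \*: (ln (R:=R) \o (cst 1 \+ (v e) \*: (@id R))))
     ((e \in S)%:R *: (((cst 1 \+ (v e) \*: (@id R)) t)^-1 * (0 + v e *: 1))).
    exact: is_deriveZ.
  rewrite (_ : (fun _ => _) = ((e \in S)%:R \*: (ln (R:=R) \o (cst 1 \+ (v e) \*: (@id R)))));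
    last first.
    by apply/funext => x; rewrite /= /GRing.scale /= mulrC [x * _]mulrC.
  apply: is_derive_eq; rewrite /= /GRing.scale /= [v e * t]mulrC; field.
  by rewrite gt_eqF.
- move=> S t tI; apply: is_derive_finsum => e.
  have p := pos e t tI.
  have h1 : is_derive t 1 ((v e) \*: (@id R)) (v e *: 1) by exact: is_deriveZ.
  have h2 : is_derive t 1 (cst 1 \+ (v e) \*: (@id R)) (0 + v e *: 1).
    by apply: is_deriveD.
  have p' : (cst 1 \+ (v e) \*: (@id R)) t != 0.
    by rewrite /= /GRing.scale /= mulrC gt_eqF.
  have h3 := is_deriveV p' h2.
  have h4 := is_deriveZ (v e * (e \in S)%:R) h3.
  rewrite (_ : (fun _ => _) = ((v e * (e \in S)%:R) \*:
      (fun x => ((cst 1 \+ (v e) \*: (@id R)) x)^-1))); last first.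
    by apply/funext => x; rewrite /= /GRing.scale /= mulrAC [x * _]mulrC.
  apply: is_derive_eq; rewrite /= /GRing.scale /= [v e * t]mulrC; field.
  by rewrite gt_eqF.
move=> t tI; rewrite mul0r subr_le0.
(* Monomials are multiaffine, so [Y1 ^ 2 + Y2] is [quad x S]; log-concavity at the point [1 + t v]
   is then [quad_le] at the field [h + y]. *)
pose y e := ln (1 + t * v e); pose x e := v e / (1 + t * v e).
have x_sg e : e \in sg -> x e = 0 by move=> /z1 ze; rewrite /x /v ze subrr mul0r.
have tE S : above sg S * expR (lin y S) = above_wgt B (fun e => h e + y e) sg S.
  rewrite /above_wgt /basis_wgt -!mulrA -expRD; congr (_ * (_ * expR _)).
  by rewrite /lin -big_split; apply: eq_bigr => e _ /=; rewrite mulrDl.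
have := quad_le HB rank (fun e => h e + y e) x_sg.
under eq_bigr do rewrite -tE.
under [X in _ * X <= _]eq_bigr do rewrite -tE.
under [X in _ <= X ^+ 2]eq_bigr do rewrite -tE.
rewrite mulrC => H; apply: le_trans H; rewrite le_eqVlt; apply/orP; left; apply/eqP.
congr (_ * _); apply: eq_bigr => S _; congr (_ * _); rewrite /quad.
congr (_ + _); rewrite /lin -sumrN; apply: eq_bigr => e _; by rewrite mulNr.
Qed.

End Fixed.
End BaseCase.

(** * Factorisation of the entropy along chains of links *)

Section BaseEntropy.
Variables (R : realType) (N : nat) (B : {set {set 'I_N}}) (r : nat).
Hypothesis HB : is_matroid_bases B.
Hypothesis rank : forall S, S \in B -> #|S| = r.
Implicit Types (sg S : {set 'I_N}) (e f : 'I_N) (u : 'I_N -> R).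
Variables (h : 'I_N -> R) (F : {set 'I_N} -> R).
Hypothesis F_gt0 : forall S, 0 < F S.
Local Notation above := (above_wgt B h).
Local Notation deg := (degree B h).
Local Notation base_wgt := (basis_wgt B h).

Definition link_ent sg : R :=
  fent (fun i => (i \notin sg)%:R * base_wgt (i |: sg)) (fun i => F (i |: sg)).

Lemma base_wgt_ge0 S : 0 <= base_wgt S.
Proof. by rewrite mulr_ge0 ?expR_ge0. Qed.

Lemma link_ent_ge0 sg : 0 <= link_ent sg.
Proof. by apply: fent_ge0 => // i; rewrite mulr_ge0 ?base_wgt_ge0. Qed.

Lemma sum_above_full sg (g : {set 'I_N} -> R) : #|sg| = r ->
  \sum_S above sg S * g S = base_wgt sg * g sg.
Proof.
move=> sr; rewrite (bigD1 sg) //= big1 ?addr0 /above_wgt ?fintype.subxx ?mul1r // => S neS.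
case: (boolP (sg \subset S)) => [sS|_]; last by rewrite !mul0r.
rewrite /basis_wgt; case: (boolP (S \in B)) => SB; last by rewrite mul0r mulr0 mul0r.
by move/negP: neS; case; rewrite eq_sym eqEcard sS (rank SB) sr /=.
Qed.

Lemma sum_above_link sg (g : {set 'I_N} -> R) : #|sg|.+1 = r ->
  \sum_S above sg S * g S =
  \sum_i (i \notin sg)%:R * base_wgt (i |: sg) * g (i |: sg).
Proof.
move=> sr; transitivity (\sum_S \sum_i above sg S * off R sg S i * g S).
  apply: eq_bigr => S _; under eq_bigr do rewrite -mulrA.
  rewrite -mulr_sumr -mulr_suml -[g S in LHS]mul1r; apply: above_ind => SB sS.
  by rewrite (@sum_off R N B r rank sg S 1) // addn1.
rewrite exchange_big; apply: eq_bigr => i _ /=.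
case: (boolP (i \in sg)) => [isg|isg].
  by rewrite !mul0r big1 // => S _; rewrite /off isg mulr0 mul0r.
rewrite mul1r -sum_above_full; last by rewrite cardsU1 isg add1n.
by apply: eq_bigr => S _; rewrite above_setU1.
Qed.

(** Averaging over a random element of the basis, [k.+1] times the entropy is the sum of the
    conditional entropies plus the entropy of the one-element marginal. Entropic independence bounds
    the latter by one copy of the entropy, leaving [k]. *)
Lemma ent_above_chain sg k : (#|sg| + k.+1)%N = r ->
  k%:R * fent (above sg) F <= \sum_(e | e \notin sg) fent (above (e |: sg)) F.
Proof.
move=> kr; have a0 := above_ge0 B h sg.
have [az|Z0] := mass_dichotomy a0.
  rewrite (funext az) fent0 mulr0; apply: sumr_ge0 => e _.
  by apply: fent_ge0 => // S; exact: above_ge0.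
have M0 := sum_mul_gt0 a0 F_gt0 Z0.
set Z := \sum_S above sg S in Z0; set M := \sum_S above sg S * F S in M0.
pose Ze e := deg sg e.
pose Me e := \sum_S above sg S * off R sg S e * F S.
have Me0 e : Ze e = 0 -> Me e = 0.
  move=> /eqP; rewrite psumr_eq0 => [/allP H|S _]; last first.
    by rewrite mulr_ge0 ?above_ge0 ?off_ge0.
  by apply: big1 => S _; have /eqP -> := H S (mem_index_enum S); rewrite mul0r.
have Ze0 e : 0 <= Ze e by exact: deg_ge0.
have Mep e : Ze e != 0 -> 0 < Ze e /\ 0 < Me e.
  move=> ne; have p : 0 < Ze e by rewrite lt_neqAle eq_sym ne Ze0.
  split=> //; apply: sum_mul_gt0 => // S.
  by rewrite mulr_ge0 ?above_ge0 ?off_ge0.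
have sg0 e : e \in sg -> Ze e = 0.
  by move=> esg; apply: big1 => S _; rewrite /off esg mulr0.
(* The test weight [\prod_(e in S) z e] is optimal for product-like [F]; its
   mean is at most 1 because the tangent term vanishes by homogeneity. *)
pose z e := if Ze e == 0 then 1 else Me e / Ze e / (M / Z).
have z0 e : 0 < z e.
  by rewrite /z; case: eqVneq => // /Mep [p q]; rewrite !divr_gt0.
have z1 e : e \in sg -> z e = 1 by move=> /sg0 Zz; rewrite /z Zz eqxx.
have z1' e : e \in sg -> z e - 1 = 0 by move=> /z1 ->; rewrite subrr.
have lz0 e : e \in sg -> ln (z e) = 0 by move=> /z1 ->; rewrite ln1.
have gp := ln_genpoly_le HB rank z0 z1 Z0.
have sumM : \sum_e Me e = k.+1%:R * M.
  rewrite exchange_big mulr_sumr; apply: eq_bigr => S _ /=.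
  rewrite -mulr_suml -mulr_sumr mulrCA -mulrA; apply: above_ind => SB sS.
  by rewrite (sum_off R rank SB sS kr).
have lin0 : \sum_S above sg S * lin (fun e => z e - 1) S = 0.
  rewrite -(sum_deg_mul B h z1').
  transitivity (\sum_e (Me e * (Z / M) - Ze e)).
    apply: eq_bigr => e _; rewrite -/(Ze e) /z.
    case: eqVneq => [Zz|ne]; first by rewrite (Me0 _ Zz) Zz; ring.
    by have [p q] := Mep _ ne; field; rewrite !gt_eqF.
  rewrite sumrB -mulr_suml sumM (sum_deg rank h kr) -/Z.
  by field; rewrite gt_eqF.
rewrite lin0 mul0r addr0 in gp.
have := fent_donsker_varadhan a0 F_gt0 (fun S => expR_gt0 (lin (fun e => ln (z e)) S)).
have G0 := sum_mul_gt0 a0 (fun S => expR_gt0 (lin (fun e => ln (z e)) S)) Z0.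
rewrite ln_div ?posrE // -/M -/Z => DV.
have {}DV : \sum_S above sg S * (F S * lin (fun e => ln (z e)) S) <= fent (above sg) F.
  have E : \sum_S above sg S * (F S * ln (expR (lin (fun e => ln (z e)) S))) =
      \sum_S above sg S * (F S * lin (fun e => ln (z e)) S).
    by apply: eq_bigr => S _; rewrite expRK.
  rewrite E in DV; have := ler_wpM2l (ltW M0) gp; rewrite -/Z; lra.
have eDV : \sum_S above sg S * (F S * lin (fun e => ln (z e)) S) =
    \sum_e Me e * ln (Me e / Ze e) - k.+1%:R * M * ln (M / Z).
  transitivity (\sum_e Me e * ln (z e)).
    transitivity (\sum_S \sum_e above sg S * off R sg S e * F S * ln (z e)).
      apply: eq_bigr => S _; rewrite (lin_off _ lz0) !mulr_sumr.
      by apply: eq_bigr => e _; ring.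
    by rewrite exchange_big; apply: eq_bigr => e _ /=; rewrite mulr_suml.
  rewrite -sumM mulr_suml -sumrB; apply: eq_bigr => e _.
  rewrite /z; case: eqVneq => [/Me0 ->|/Mep [p q]]; first by rewrite !mul0r subrr.
  by rewrite [ln (_ / (M / Z))]ln_div ?posrE ?divr_gt0 // mulrBr.
have -> : \sum_(e | e \notin sg) fent (above (e |: sg)) F =
    k.+1%:R * (\sum_S above sg S * (F S * ln (F S))) - \sum_e Me e * ln (Me e / Ze e).
  have -> : k.+1%:R * (\sum_S above sg S * (F S * ln (F S))) =
      \sum_e \sum_S above sg S * off R sg S e * (F S * ln (F S)).
    rewrite exchange_big mulr_sumr; apply: eq_bigr => S _ /=.
    rewrite -mulr_suml -mulr_sumr mulrCA -[RHS]mulrA; apply: above_ind => SB sS.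
    by rewrite (sum_off R rank SB sS kr).
  rewrite -sumrB big_mkcond; apply: eq_bigr => e _ /=.
  case: (boolP (e \in sg)) => esg /=.
    rewrite (Me0 _ (sg0 _ esg)) mul0r subr0 big1 // => S _.
    by rewrite /off esg mulr0 mul0r.
  rewrite (eq_fent _ (fun S => above_setU1 B h S esg)) /fent.
  by congr (_ - _ * ln (_ / _)).
have : k.+1%:R * (\sum_S above sg S * (F S * ln (F S))) - k.+1%:R * M * ln (M / Z) =
  k.+1%:R * fent (above sg) F by rewrite /fent -/M -/Z; ring.
rewrite -natr1; lra.
Qed.

(** The factor lost at each level of the chain is exactly the number of ways to reach [t] from it,
    so the constant stays 1. *)
Lemma ent_above_le k sg : (#|sg| + k)%N = r ->
  fent (above sg) F <= \sum_(t : {set 'I_N} | sg \subset t) link_ent t.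
Proof.
have R0 sg' : 0 <= \sum_(t : {set 'I_N} | sg' \subset t) link_ent t.
  by apply: sumr_ge0 => t _; exact: link_ent_ge0.
elim: k sg => [|k IH] sg kr.
  have sr : #|sg| = r by rewrite -kr addn0.
  rewrite /fent !(sum_above_full _ sr).
  have -> : \sum_S above sg S = base_wgt sg.
    by rewrite -[RHS]mulr1 -(sum_above_full (fun=> 1) sr); apply: eq_bigr => S _; rewrite mulr1.
  apply: le_trans (R0 sg); have [->|b0] := eqVneq (base_wgt sg) 0; first by rewrite !mul0r subr0.
  by rewrite [_ * F sg / _]mulrAC divff // mul1r mulrA subrr.
case: k IH kr => [_|k IH] kr.
  have sr : #|sg|.+1 = r by rewrite -kr addn1.
  have -> : fent (above sg) F = link_ent sg.
    rewrite /link_ent /fent !(sum_above_link _ sr).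
    have -> // : \sum_S above sg S = \sum_i (i \notin sg)%:R * base_wgt (i |: sg).
    transitivity (\sum_S above sg S * 1); first by apply: eq_bigr => S _; rewrite mulr1.
    by rewrite (sum_above_link _ sr); apply: eq_bigr => i _; rewrite mulr1.
  by rewrite (bigD1 sg) //= lerDl; apply: sumr_ge0 => t _; exact: link_ent_ge0.
have k0 : 0 < k.+1%:R :> R by rewrite ltr0n.
rewrite -(ler_pM2l k0); apply: le_trans (ent_above_chain kr) _.
apply: le_trans (_ : \sum_(e | e \notin sg)
    \sum_(t : {set 'I_N} | (e |: sg) \subset t) link_ent t <= _).
  apply: ler_sum => e esg; apply: IH.
  by rewrite cardsU1 esg -kr add1n addSnnS.
rewrite (exchange_big_dep (fun t : {set 'I_N} => sg \subset t)) /=; last first.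
  by move=> e t _; rewrite finset.subUset => /andP [].
rewrite mulr_sumr; apply: ler_sum => t st.
rewrite sumr_const -[leLHS]mulr_natl.
(* A nonzero link entropy forces [t] to miss one element of a basis, so that [t :\: sg] has [k.+1]
   elements. *)
have [L0|Ln0] := eqVneq (link_ent t) 0; first by rewrite L0 !mulr0.
apply: ler_wpM2r; first exact: link_ent_ge0.
rewrite ler_nat.
have [i /andP [it iB]] : exists i, (i \notin t) && (i |: t \in B).
  apply/existsP; rewrite -[X in is_true X]negbK negb_exists; apply/negP => /forallP H.
  move/eqP: Ln0; apply; rewrite /link_ent (eq_fent (a' := fun=> 0)) ?fent0 // => i.
  have := H i; rewrite /basis_wgt; case: (i \notin t); rewrite ?mul0r //=.
  by move=> /negbTE ->; rewrite mul0r mulr0.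
have ct : #|t|.+1 = r by rewrite -(rank iB) cardsU1 it add1n.
apply: leq_trans (_ : #|t :\: sg| <= _)%N.
  apply: subset_leq_card; apply/fintype.subsetP => e.
  rewrite unfold_in finset.subUset finset.sub1set => /and3P [esg et _].
  by rewrite inE esg et.
by rewrite (cardsDS st) leq_subLR -ltnS ct -kr addnS.
Qed.

End BaseEntropy.

Lemma ent_bound0 (R : realType) (N : nat) (B : {set {set 'I_N}})
    (th : 'I_N -> 'I_N -> R) : is_matroid_bases B -> ent_bound B th 1 0.
Proof.
move=> HB h F F0; have [A AB] := proj1 HB.
have rank S : S \in B -> #|S| = #|A| by move=> SB; exact: (bases_card HB SB AB).
rewrite wgt0E mul1r -above0E.
have := @ent_above_le R N B #|A| HB rank h F F0 #|A| finset.set0.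
rewrite cards0 add0n => /(_ erefl) H; apply: le_trans H _.
rewrite /links_ent (eq_bigl predT); last by move=> t; rewrite finset.sub0set.
by apply: ler_sum => t _; rewrite above0E.
Qed.

(** * The down-up walk *)

Section EntCov.
Variables (R : realType) (T : finType) (a f : T -> R).
Hypothesis a_ge0 : forall i, 0 <= a i.
Hypothesis f_gt0 : forall i, 0 < f i.

(** The right-hand side is the symmetrised covariance of [f] and [ln f]. It differs from [fent] only
    in having the mean of [ln f] where [fent] has [ln] of the mean, so Jensen's inequality
    suffices. *)
Lemma fent_le_covariance : fent a f <=
  2^-1 * \sum_i a i * \sum_j a j / (\sum_k a k) * (f j - f i) * (ln (f j) - ln (f i)).
Proof.
have [az|Z0] := mass_dichotomy a_ge0.
  by rewrite (funext az) fent0 big1 ?mulr0 // => i _; rewrite mul0r.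
have M0 := sum_mul_gt0 a_ge0 f_gt0 Z0.
rewrite /fent; set L := \sum_k a k in Z0 *; set M := \sum_i a i * f i in M0 *.
pose X := \sum_i a i * (f i * ln (f i)); pose Y := \sum_i a i * ln (f i).
have -> : 2^-1 * \sum_i a i * \sum_j a j / L * (f j - f i) * (ln (f j) - ln (f i)) =
    X - M * Y / L.
  transitivity (2^-1 * \sum_i (a i / L * X - a i * ln (f i) / L * M
      - a i * f i / L * Y + a i * (f i * ln (f i)) / L * L)).
    congr (_ * _); apply: eq_bigr => i _.
    rewrite /X /M /Y /L !mulr_sumr -!sumrB -big_split; apply: eq_bigr => j _ /=.
    ring.
  rewrite big_split !sumrB /= -!mulr_suml -/L -/X -/M -/Y.
  by field; rewrite gt_eqF.
rewrite lerD2l lerN2 ler_pdivrMr // -mulrA ler_pM2l //.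
have c0 : 0 < M / L by rewrite divr_gt0.
have H i : a i * ln (f i) <= a i * (ln (M / L) + f i / (M / L) - 1).
  apply: ler_wpM2l => //.
  have p : 0 < f i / (M / L) by rewrite divr_gt0.
  by have := ln_le_subr1 p; rewrite ln_div ?posrE //; lra.
have := ler_sum (index_enum T) (fun i (_ : true) => H i).
have gen (c : R) : \sum_i a i * (ln c + f i / c - 1) = ln c * L + M / c - L.
  rewrite [X in _ = X + _ - _]mulr_sumr [X in _ = _ + X - _]mulr_suml -big_split -sumrB.
  by apply: eq_bigr => i _ /=; ring.
rewrite gen.
have -> : M / (M / L) = L by field; rewrite !gt_eqF.
by rewrite addrK.
Qed.

End EntCov.

Section Configurations.
Variable N : nat.
Implicit Types (w : config N) (S : {set 'I_N}).

Definition cfg S : config N := [ffun e => e \in S].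

Lemma cfgK : cancel cfg (@occ N).
Proof. by move=> S; apply/setP => e; rewrite inE ffunE. Qed.

Lemma occK : cancel (@occ N) cfg.
Proof. by move=> w; apply/ffunP => e; rewrite ffunE inE. Qed.

Lemma sum_config (R : nmodType) (g : {set 'I_N} -> R) :
  \sum_w g (occ w) = \sum_S g S.
Proof. by rewrite [RHS](reindex (@occ N)) //; exists cfg => x _; rewrite ?occK ?cfgK. Qed.

Lemma occ_exch (B : {set {set 'I_N}}) w i j : i \in occ w -> j \in J B w i ->
  occ (exch w i j) = j |: (occ w :\ i).
Proof.
rewrite !inE => wi /andP [jw _]; apply/setP => e; rewrite !inE ffunE.
have [->|ji] := eqVneq j i; first by rewrite tperm1 perm1; case: eqVneq => [->|].
have wj : w j = false by move: jw; rewrite ji /= => /negbTE.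
case: tpermP => [->|->|/eqP ei /eqP ej].
- by rewrite wj eq_sym (negbTE ji) eqxx.
- by rewrite wi eqxx.
- by rewrite ei (negbTE ej).
Qed.

Lemma sum_remove (R : nmodType) (g : {set 'I_N} -> 'I_N -> R) :
  \sum_(S : {set 'I_N}) \sum_(i in S) g S i = \sum_(t : {set 'I_N}) \sum_(i | i \notin t) g (i |: t) i.
Proof.
rewrite (exchange_big_dep predT) //= [RHS](exchange_big_dep predT) //=.
apply: eq_bigr => i _.
rewrite (reindex_onto (fun t => i |: t) (fun S => S :\ i)) /=; last first.
  by move=> S iS; rewrite finset.setD1K.
apply: eq_bigl => t; rewrite finset.setU11 /=.
apply/eqP/idP => [<-|it]; first by rewrite !inE eqxx.
by rewrite finset.setU1K.
Qed.

End Configurations.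

(** * The tilted measure and its Dirichlet form *)

Section TiltedMeasure.
Variables (R : realType) (N : nat) (B : {set {set 'I_N}}) (eps : 'I_N -> 'I_N -> R).
Hypothesis HB : is_matroid_bases B.
Hypothesis eps_gt : forall e f, -1 < eps e f.

Let th e f := ln (1 + eps e f).
Let a := wgt B th 1 (fun=> 0).

Lemma tilt_weightE w : tilt_weight eps B w = a (occ w) / #|B|%:R.
Proof.
rewrite /tilt_weight /unif_bases mulrA; congr (_ / _).
rewrite /a /wgt mulrC; congr (_ * _).
rewrite (_ : lin _ _ = 0) ?add0r ?mul1r; last by apply: big1 => e _; rewrite mul0r.
rewrite /pair_energy expR_sum; apply: eq_bigr => e _.
rewrite expR_sum; apply: eq_bigr => f _; rewrite !inE /th.
case: (w e); case: (w f); rewrite ?mulr1 ?mulr0 ?mul0r ?addr0 ?expR0 //.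
by rewrite lnK // posrE; have := eps_gt e f; lra.
Qed.

Lemma tiltE : exists2 c : R, 0 < c &
  (forall w, tilt eps B w = c * a (occ w)) /\ c * \sum_S a S = 1.
Proof.
have Z0 : 0 < \sum_S a S by exact: wgt_mass_gt0 (proj1 HB).
have B0 : 0 < #|B|%:R :> R.
  by have [A AB] := proj1 HB; rewrite ltr0n; apply/card_gt0P; exists A.
exists (\sum_S a S)^-1; first by rewrite invr_gt0.
split; last by rewrite mulVf // gt_eqF.
move=> w; rewrite /tilt tilt_weightE.
have -> : \sum_v tilt_weight eps B v = (\sum_S a S) / #|B|%:R.
  rewrite mulr_suml -(sum_config (fun S => a S / #|B|%:R)).
  by apply: eq_bigr => v _; exact: tilt_weightE.
by field; rewrite !gt_eqF.
Qed.

Variable F : config N -> R.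
Hypothesis F_gt0 : forall w, 0 < tilt eps B w -> 0 < F w.

(** [F] is positive only on the support, while the entropy lemmas want positivity everywhere; the
    value 1 off the bases carries no weight. *)
Definition ext_fun S : R := if S \in B then F (cfg S) else 1.

Lemma a_gt0 S : S \in B -> 0 < a S.
Proof. by move=> SB; rewrite /a /wgt SB mulr_gt0 ?expR_gt0 ?ltr01. Qed.

Lemma a_eq0 S : S \notin B -> a S = 0.
Proof. by move=> /negbTE SB; rewrite /a /wgt SB mul0r. Qed.

Lemma ext_fun_gt0 S : 0 < ext_fun S.
Proof.
rewrite /ext_fun; case: ifP => // SB; apply: F_gt0.
by have [c c0 [-> _]] := tiltE; rewrite mulr_gt0 // cfgK a_gt0.
Qed.

Lemma ext_fun_occ w : occ w \in B -> ext_fun (occ w) = F w.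
Proof. by rewrite /ext_fun => ->; rewrite occK. Qed.

Lemma Ent_tilt c : 0 < c -> (forall w, tilt eps B w = c * a (occ w)) ->
  c * \sum_S a S = 1 -> Ent (tilt eps B) F = c * fent a ext_fun.
Proof.
move=> c0 tE c1; rewrite -fentZ //.
have E (k k' : {ffun 'I_N -> bool} -> R) (g : {set 'I_N} -> R) :
    (forall w, occ w \in B -> k w = g (occ w)) ->
    Emu (tilt eps B) k = \sum_S c * a S * g S.
  move=> kg; rewrite -(sum_config (fun S => c * a S * g S)); apply: eq_bigr => w _.
  rewrite tE; have [wB|wB] := boolP (occ w \in B); first by rewrite kg.
  by rewrite (a_eq0 wB) mulr0 !mul0r.
rewrite /Ent /fent (E _ F (fun S => ext_fun S * ln (ext_fun S))); last first.
  by move=> w wB; rewrite ext_fun_occ.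
rewrite (E _ F ext_fun); last by move=> w wB; rewrite ext_fun_occ.
by rewrite -[\sum_i c * a i]mulr_sumr c1 divr1.
Qed.

(** Grouped by [t = S :\ i], the down-up walk resamples [i] from the normalised weight of the link
    of [t], so the form is the sum over [t] of the covariances of [F] and [ln F] on links. *)
Lemma links_le_D_du c : 0 < c -> (forall w, tilt eps B w = c * a (occ w)) ->
  c * links_ent a ext_fun <= D_du B (tilt eps B) F (fun w => ln (F w)).
Proof.
move=> c0 tE.
pose al (t : {set 'I_N}) i := (i \notin t)%:R * a (i |: t).
pose fl (t : {set 'I_N}) i := ext_fun (i |: t).
pose L t := \sum_i al t i.
pose g S i : R := c * a S * \sum_j al (S :\ i) j / L (S :\ i)
  * (fl (S :\ i) j - fl (S :\ i) i) * (ln (fl (S :\ i) j) - ln (fl (S :\ i) i)).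
have -> : D_du B (tilt eps B) F (fun w => ln (F w)) = 2^-1 *
    \sum_(S : {set 'I_N}) \sum_(i in S) g S i.
  rewrite /D_du -(sum_config (fun S : {set 'I_N} => \sum_(i in S) g S i)); congr (_ * _).
  apply: eq_bigr => w _; rewrite mulr_sumr; apply: eq_bigr => i iw; rewrite tE /g.
  have [wB|wB] := boolP (occ w \in B); last by rewrite (a_eq0 wB) mulr0 !mul0r.
  congr (_ * _); set t := occ w :\ i.
  have it : i |: t = occ w by rewrite finset.setD1K.
  have JE j : (j \in J B w i) = (j \notin t) && (j |: t \in B).
    by rewrite /J inE finset.in_setC finset.setUC.
  have tJ j : j \in J B w i -> tilt eps B (exch w i j) = c * al t j.
    move=> jJ; rewrite tE (occ_exch iw jJ) -/t /al; move: jJ; rewrite JE => /andP [-> _].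
    by rewrite mul1r.
  have nJ j : j \notin J B w i -> al t j = 0.
    rewrite JE negb_and negbK /al => /orP [->|/a_eq0 ->]; first by rewrite mul0r.
    by rewrite mulr0.
  have LE : \sum_(k in J B w i) tilt eps B (exch w i k) = c * L t.
    rewrite (eq_bigr _ tJ) -mulr_sumr; congr (_ * _); rewrite big_mkcond.
    by apply: eq_bigr => j _; case: ifP => // /negbT /nJ.
  rewrite LE big_mkcond; apply: eq_bigr => j _.
  case: ifP => [jJ|/negbT /nJ ->]; last by rewrite !mul0r.
  rewrite (tJ _ jJ) -mulf_div divff ?gt_eqF // mul1r.
  have Fw : F w = fl t i by rewrite /fl it ext_fun_occ.
  have Fj : F (exch w i j) = fl t j.
    rewrite /fl -(occ_exch iw jJ) ext_fun_occ // (occ_exch iw jJ).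
    by move: jJ; rewrite JE => /andP [].
  by rewrite Fw Fj.
rewrite sum_remove /links_ent !mulr_sumr; apply: ler_sum => t _.
have al0 i : 0 <= al t i by rewrite mulr_ge0 ?wgt_ge0.
apply: le_trans (ler_wpM2l (ltW c0) (fent_le_covariance al0 (fun i => ext_fun_gt0 (i |: t)))) _.
rewrite mulrCA ler_pM2l ?invr_gt0 // mulr_sumr [leRHS]big_mkcond /=.
rewrite le_eqVlt; apply/orP; left; apply/eqP; apply: eq_bigr => i _.
case: (boolP (i \notin t)) => it; last by rewrite /al (negbTE it) !mul0r mulr0.
by rewrite /g finset.setU1K // /al it mul1r mulrA.
Qed.

End TiltedMeasure.

Lemma norm_ln1D_le (R : realType) (x : R) : `|x| <= 2^-1 -> `|ln (1 + x)| <= 2 * `|x|.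
Proof.
rewrite ler_norml => /andP [x1 x2]; have p : 0 < 1 + x by lra.
have h1 : ln (1 + x) <= x by apply: le_ln1Dx; lra.
have h2 : - (2 * `|x|) <= ln (1 + x).
  have q : 0 < (1 + x)^-1 by rewrite invr_gt0.
  have := ln_le_subr1 q; rewrite lnV ?posrE //.
  have -> : (1 + x)^-1 - 1 = - x / (1 + x) by field; rewrite gt_eqF.
  have : - x / (1 + x) <= 2 * `|x|.
    rewrite ler_pdivrMr //; have := ler_norm (- x); rewrite normrN.
    have := normr_ge0 x; nra.
  lra.
rewrite ler_norml h2 /=; apply: le_trans h1 _.
by have := ler_norm x; have := normr_ge0 x; lra.
Qed.

Theorem theorem1p7 (R : realType) :
  exists (eps0 : R) (C : R -> R),
    0 < eps0 /\
    (forall x : R, 0 <= x -> x <= eps0 -> 0 < C x) /\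
    forall (N : nat) (B : {set {set 'I_N}}) (eps : 'I_N -> 'I_N -> R)
           (F : config N -> R),
      (0 < N)%N ->
      is_matroid_bases B ->
      (forall e f : 'I_N, eps e f = eps f e) ->
      (forall e f : 'I_N, -1 < eps e f) ->
      eps_bar eps <= eps0 ->
      (forall w : config N, 0 < tilt eps B w -> 0 < F w) ->
      Ent (tilt eps B) F
        <= C (eps_bar eps) * D_du B (tilt eps B) F (fun w => ln (F w)).
Proof.
(* [|ln (1 + x)| <= 2 |x|] turns row sums of [eps] at most 1/160 into row sums of [th] at most
   1/80. *)
exists 160^-1, (fun=> 2); split; first by rewrite invr_gt0.
split=> // N B eps F N0 HB epsC eps_gt eps_le F0.
pose th e f := ln (1 + eps e f).
have row_eps e : \sum_f `|eps e f| <= 160^-1.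
  apply: le_trans eps_le; rewrite /eps_bar.
  exact: (le_bigmax_cond _ (fun e => \sum_f `|eps e f|)).
have eps_small e f : `|eps e f| <= 160^-1.
  apply: le_trans (row_eps e); rewrite (bigD1 f) //= lerDl.
  by apply: sumr_ge0.
have row_th e : \sum_f `|th e f| <= 80^-1.
  apply: le_trans (_ : \sum_f 2 * `|eps e f| <= _).
    by apply: ler_sum => f _; apply: norm_ln1D_le; have := eps_small e f; lra.
  by rewrite -mulr_sumr; have := row_eps e; lra.
have thC e f : th e f = th f e by rewrite /th epsC.
have T0 : 0 <= (80^-1 : R) by rewrite invr_ge0.
have EB := ent_bound_of_base N0 (proj1 HB) thC row_th T0 (lexx _).
have [A AB] := proj1 HB.
have rank S : S \in B -> #|S| = #|A| by move=> SB; exact: (bases_card HB SB AB).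
have {}EB := EB (cov_bound0 HB rank th) (ent_bound0 th HB).
have [c c0 [tE c1]] := tiltE HB eps_gt.
rewrite (Ent_tilt F c0 tE c1).
have H := EB (fun=> 0) _ (ext_fun_gt0 HB eps_gt F0).
apply: le_trans (ler_wpM2l (ltW c0) H) _; rewrite mulrCA ler_wpM2l //.
exact: links_le_D_du.
Qed.
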